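(* Let $\Omega\subseteq\mathbb{R}^n$ be a bounded open set with Lipschitz boundary. If $u$ is a minimizer of $\mathcal{F}$ in $\Omega$ and $u\in L^\infty(\Omega_d\setminus\Omega)$ for some $d>0$, then $u\in L^\infty(\Omega)$ and it holds $$\|u\|_{L^\infty(\Omega\setminus\Omega_{-\theta d})}\le d+\max\left\{\|u\|_{L^\infty(\Omega_{-\theta d})},\|u\|_{L^\infty(\Omega_d\setminus\Omega)}\right\},$$ for some constant $\theta\in(0,1)$ depending only on $n$, $s$, $\Omega$, and $g$.
   Context: $n\ge1$ is an integer, $s\in(0,1)$, and $g:\mathbb{R}\to(0,1]$ is an even continuous function with $\int_{\mathbb{R}}g(t)|t|\,dt<\infty$. Set $G(t):=\int_0^t g(\tau)\,d\tau$ and $\mathcal{G}(t):=\int_0^t G(\tau)\,d\tau$. $Q(\Omega):=\mathbb{R}^{2n}\setminus(\mathbb{R}^n\setminus\Omega)^2$; $\mathcal{W}^s(\Omega)$ is the set of measurable $u:\mathbb{R}^n\to\mathbb{R}$ with $u|_\Omega\in L^1(\Omega)$ and $\int_\Omega\int_\Omega\frac{|u(x)-u(y)|}{|x-y|^{n+s}}\,dx\,dy<\infty$. $u$ is a minimizer of $\mathcal{F}$ in $\Omega$ if $u\in\mathcal{W}^s(\Omega)$ and $$\iint_{Q(\Omega)}\left\{\mathcal{G}\left(\frac{u(x)-u(y)}{|x-y|}\right)-\mathcal{G}\left(\frac{v(x)-v(y)}{|x-y|}\right)\right\}\frac{dx\,dy}{|x-y|^{n-1+s}}\le0$$ for every $v\in\mathcal{W}^s(\Omega)$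 with $v=u$ a.e. in $\mathbb{R}^n\setminus\Omega$ (the integral converges absolutely for such $u,v$). For $\varrho\in\mathbb{R}$, $\Omega_\varrho:=\{x\in\mathbb{R}^n:\bar d_\Omega(x)<\varrho\}$, where $\bar d_\Omega$ is the signed distance function from $\partial\Omega$, negative inside $\Omega$. *)

(* Defs.v *)
From HB Require Import structures.
From mathcomp Require Import all_boot all_order all_algebra.
From mathcomp Require Import all_classical all_reals all_analysis.

Set Implicit Arguments.
Unset Strict Implicit.
Unset Printing Implicit Defensive.
Import Order.TTheory GRing.Theory Num.Theory.
Import numFieldNormedType.Exports.
Local Open Scope classical_set_scope.
Local Open Scope ring_scope.

(* Lebesgue measure on R^n, absent from the library.  On the Borel sets of
   n.-tuple R it is the iterated product of the one-dimensional measure; it is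
   then extended by Caratheodory's construction, so that the measurable subsets
   of 'rV[R]_n below are the Lebesgue-measurable ones. *)
Section product_lebesgue_measure.
Context {R : realType}.
Local Notation T := (measurableTypeR R).

Definition tuple_cons n (p : T * n.-tuple T) : n.+1.-tuple T :=
  [tuple of p.1 :: p.2].

Fixpoint lebesgue_tuple n : set (n.-tuple T) -> \bar R :=
  match n with
  | 0 => dirac [tuple]
  | m.+1 => pushforward (product_measure1 (@lebesgue_measure R)
                           (@lebesgue_tuple m)) (@tuple_cons m)
  end.
Arguments lebesgue_tuple n A : clear implicits.

Lemma measurable_tuple_cons n : measurable_fun setT (@tuple_cons n).
Proof. by apply: measurable_cons. Qed.

Lemma sigma_finite_product_measure1 d1 d2 (T1 : measurableType d1)
    (T2 : measurableType d2) (m1 : {sigma_finite_measure set T1 -> \bar R})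
    (m2 : {sigma_finite_measure set T2 -> \bar R}) :
  sigma_finite setT (product_measure1 m1 m2).
Proof.
have /sigma_finiteP[F [TF ndF Foo]] := sigma_finiteT m1.
have /sigma_finiteP[G [TG ndG Goo]] := sigma_finiteT m2.
exists (fun n => F n `*` G n).
  rewrite -setXTT TF TG predeqE => -[x y]; split.
    move=> [/= [n _ Fnx] [k _ Gky]]; exists (maxn n k) => //; split.
      by move: x Fnx; exact/subsetPset/ndF/leq_maxl.
    by move: y Gky; exact/subsetPset/ndG/leq_maxr.
  by move=> [n _ []/= ? ?]; split; exists n.
move=> k; have [? ?] := Foo k; have [? ?] := Goo k.
split; first exact: measurableX.
by rewrite product_measure1E// lte_mul_pinfty// ge0_fin_numE.
Qed.

Lemma lebesgue_tuple_measure n :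
  {m : {sigma_finite_measure set (n.-tuple T) -> \bar R} |
    lebesgue_tuple n = m :> (set (n.-tuple T) -> \bar R)}.
Proof.
elim: n => [|n [m lebE]]; first by exists (dirac ([tuple] : 0.-tuple T)).
pose P := product_measure1 (@lebesgue_measure R) m.
have mC : measurable_fun setT (@tuple_cons n) := @measurable_tuple_cons n.
pose Q' : {measure set (n.+1.-tuple T) -> \bar R} :=
  pushforward P (@tuple_cons n).
pose Q := Q' mC.
have sQ : sigma_finite setT Q.
  have [F FT mF] : sigma_finite setT P by exact: sigma_finite_product_measure1.
  have mh : measurable_fun setT (fun t : n.+1.-tuple T =>
      (tnth t ord0 : T, [tuple of behead t] : n.-tuple T)).
    apply/measurable_fun_pair; first exact: measurable_tnth.
    exact: measurable_behead.
  exists (fun k => (fun t : n.+1.-tuple T =>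
      (tnth t ord0 : T, [tuple of behead t] : n.-tuple T)) @^-1` F k).
    by rewrite -preimage_bigcup -FT preimage_setT.
  move=> k; have [mFk Fk] := mF k; split.
    by rewrite -[X in measurable X]setTI; exact: mh.
  rewrite /Q/= /pushforward (_ : _ @^-1` _ = F k)//.
  apply/seteqP; split=> -[x t] /=; rewrite (_ : [tuple of _] = t)//;
    by apply/val_inj.
pose sf := Measure_isSigmaFinite.Build _ _ _ (Q : set (n.+1.-tuple T) -> \bar R) sQ.
pose Qs : {sigma_finite_measure set (n.+1.-tuple T) -> \bar R} :=
  HB.pack (Q : set (n.+1.-tuple T) -> \bar R) (Measure.class Q) sf.
by exists Qs => /=; rewrite lebE.
Qed.

Lemma lebesgue_tuple0 n : lebesgue_tuple n set0 = 0%E.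
Proof. by have [m ->] := lebesgue_tuple_measure n; exact: measure0. Qed.

Lemma lebesgue_tuple_ge0 n A : (0 <= lebesgue_tuple n A)%E.
Proof. by have [m ->] := lebesgue_tuple_measure n; exact: measure_ge0. Qed.

Lemma lebesgue_tuple_semi_sigma_additive n :
  semi_sigma_additive (lebesgue_tuple n).
Proof.
by have [m ->] := lebesgue_tuple_measure n; exact: measure_semi_sigma_additive.
Qed.

HB.instance Definition _ n := isMeasure.Build _ (n.-tuple T) R
  (lebesgue_tuple n) (lebesgue_tuple0 n) (@lebesgue_tuple_ge0 n)
  (@lebesgue_tuple_semi_sigma_additive n).

Lemma lebesgue_tuple_sigma_finite n : sigma_finite setT (lebesgue_tuple n).
Proof. by have [m ->] := lebesgue_tuple_measure n; exact: sigma_finiteT. Qed.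

HB.instance Definition _ n := Measure_isSigmaFinite.Build _ (n.-tuple T) R
  (lebesgue_tuple n) (@lebesgue_tuple_sigma_finite n).

Definition rV_of_tuple n (t : n.-tuple T) : 'rV[R]_n := \row_i tnth t i.

Definition lebesgue_outer n (A : set 'rV[R]_n) : \bar R :=
  ((lebesgue_tuple n)^*)%mu (@rV_of_tuple n @^-1` A).

Lemma lebesgue_outer0 n : @lebesgue_outer n set0 = 0%E.
Proof. by rewrite /lebesgue_outer preimage_set0 outer_measure0. Qed.

Lemma lebesgue_outer_ge0 n (A : set 'rV[R]_n) : (0 <= lebesgue_outer A)%E.
Proof. exact: outer_measure_ge0. Qed.

Lemma le_lebesgue_outer n :
  {homo @lebesgue_outer n : A B / A `<=` B >-> (A <= B)%E}.
Proof. by move=> A B AB; apply: le_outer_measure => t; exact: AB. Qed.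

Lemma lebesgue_outer_sigma_subadditive n :
  sigma_subadditive (@lebesgue_outer n).
Proof.
move=> F; rewrite /lebesgue_outer preimage_bigcup.
exact: outer_measure_sigma_subadditive.
Qed.

HB.instance Definition _ n := isOuterMeasure.Build R 'rV[R]_n
  (@lebesgue_outer n) (@lebesgue_outer0 n) (@lebesgue_outer_ge0 n)
  (@le_lebesgue_outer n) (@lebesgue_outer_sigma_subadditive n).

End product_lebesgue_measure.
Arguments lebesgue_tuple {R} n A.

(* R^n as a measurable type: a copy of 'rV[R]_n whose measurable sets are the
   Lebesgue-measurable sets. *)
Definition Rn (R : realType) (n : nat) : measurableType _ :=
  caratheodory_type (@lebesgue_outer R n).

Definition lebesgue (R : realType) (n : nat) : set (Rn R n) -> \bar R :=
  @lebesgue_outer R n.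
Arguments lebesgue {R} n.

Lemma lebesgue_semi_sigma_additive (R : realType) (n : nat) :
  semi_sigma_additive (@lebesgue R n).
Proof. exact: caratheodory_measure_sigma_additive. Qed.

HB.instance Definition _ (R : realType) (n : nat) :=
  isMeasure.Build _ (Rn R n) R (@lebesgue R n)
    (@lebesgue_outer0 R n) (@lebesgue_outer_ge0 R n)
    (@lebesgue_semi_sigma_additive R n).

Lemma lebesgue_sigma_finite (R : realType) (n : nat) :
  sigma_finite setT (@lebesgue R n).
Proof.
have [F FT mF] := @lebesgue_tuple_sigma_finite R n.
pose h (x : 'rV[R]_n) : n.-tuple (measurableTypeR R) := [tuple x ord0 i | i < n].
have hK : cancel h (@rV_of_tuple R n).
  by move=> x; apply/rowP => i; rewrite mxE tnth_mktuple.
have Kh : cancel (@rV_of_tuple R n) h.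
  by move=> t; apply: eq_from_tnth => i; rewrite tnth_mktuple mxE.
have hE (A : set (n.-tuple (measurableTypeR R))) :
    @rV_of_tuple R n @^-1` (h @^-1` A) = A.
  by apply/seteqP; split=> t /=; rewrite Kh.
exists (fun k => h @^-1` F k); first by rewrite -preimage_bigcup -FT preimage_setT.
move=> k; have [mFk Fk] := mF k; split.
  move=> X; have := caratheodory_measurable_mu_ext (lebesgue_tuple n) mFk.
  move=> /(_ (@rV_of_tuple R n @^-1` X)) E.
  by rewrite /= /lebesgue_outer !preimage_setI -preimage_setC hE.
rewrite /lebesgue/= /lebesgue_outer hE.
by rewrite (measurable_mu_extE (lebesgue_tuple n) mFk).
Qed.

HB.instance Definition _ (R : realType) (n : nat) :=
  Measure_isSigmaFinite.Build _ (Rn R n) R (@lebesgue R n)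
    (@lebesgue_sigma_finite R n).

Section euclidean.
Context {R : realType} {n : nat}.
Implicit Types (x y : 'rV[R]_n) (A Om : set 'rV[R]_n).

Definition dotr x y : R := \sum_i x ord0 i * y ord0 i.

(* The norm `|x| of the library on 'rV[R]_n is the sup norm. *)
Definition enorm x : R := Num.sqrt (dotr x x).

Definition boundary A : set 'rV[R]_n := closure A `\` interior A.

Definition edistance x A : R := inf [set enorm (x - y) | y in A].

Definition signed_distance Om x : R :=
  if x \in Om then - edistance x (boundary Om) else edistance x (boundary Om).

Definition sublevel_domain Om (rho : R) : set 'rV[R]_n :=
  [set x | signed_distance Om x < rho].

(* Near each boundary point, and up to a rotation, Om is the strict epigraph of
   a Lipschitz function of n-1 variables.  The rotated axes are given by the
   unit vector e of the vertical axis: the height of x is dotr x e, and its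
   horizontal part x - dotr x e *: e lies in the hyperplane orthogonal to e, the
   only place where the values of psi matter. *)
Definition lipschitz_boundary Om : Prop :=
  forall x0, boundary Om x0 ->
  exists (r L : R) (e : 'rV[R]_n) (psi : 'rV[R]_n -> R),
    [/\ 0 < r, enorm e = 1,
        forall y z, dotr y e = 0 -> dotr z e = 0 ->
          `|psi y - psi z| <= L * enorm (y - z) &
        forall x, enorm (x - x0) < r ->
          (Om x <-> psi (x - dotr x e *: e) < dotr x e)].

(* n > 0 makes the whole space of positive measure, so that this is the
   essential supremum of |u| over A, and 0 when A is negligible. *)
Definition Linfty_norm (u : 'rV[R]_n -> R) A : \bar R :=
  Lnorm (lebesgue n) +oo%E ((EFin \o u) \_ A).

End euclidean.

Section functional.
Context {R : realType}.

(* The oriented integral of f from 0 to t. *)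
Definition primitive0 (f : R -> R) (t : R) : R :=
  if 0 <= t then \int[@lebesgue_measure R]_(tau in `[0, t]) f tau
  else - \int[@lebesgue_measure R]_(tau in `[t, 0]) f tau.

Definition calG (g : R -> R) : R -> R := primitive0 (primitive0 g).

Context {n : nat}.
Implicit Types (Om : set 'rV[R]_n) (u v : 'rV[R]_n -> R).

Definition Q_domain Om : set (Rn R n * Rn R n) :=
  ~` ((~` Om) `*` (~` Om)).

Definition in_Ws (s : R) Om u : Prop :=
  [/\ measurable_fun [set: Rn R n] u,
      (lebesgue n).-integrable Om (EFin \o u) &
      (\int[lebesgue n]_(x in Om) \int[lebesgue n]_(y in Om)
         (`|u x - u y| / enorm (x - y) `^ (n%:R + s))%:E < +oo)%E].

(* The quotients take the value 0 on the diagonal, a null set. *)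
Definition minimizer (s : R) (g : R -> R) Om u : Prop :=
  in_Ws s Om u /\
  forall v, in_Ws s Om v ->
    {ae lebesgue n, forall x, ~ Om x -> v x = u x} ->
    (\int[product_measure1 (lebesgue n) (lebesgue n)]_(z in Q_domain Om)
       ((calG g ((u z.1 - u z.2) / enorm (z.1 - z.2)) -
         calG g ((v z.1 - v z.2) / enorm (z.1 - z.2))) /
        enorm (z.1 - z.2) `^ (n%:R - 1 + s))%:E <= 0)%E.

End functional.

(* Main.v *)
Require Import Defs.
From mathcomp Require Import all_boot all_order all_algebra.
From mathcomp Require Import all_classical all_reals all_analysis.
From mathcomp Require Import measurable_realfun ess_sup_inf.
From mathcomp Require Import ring lra.
Import Order.TTheory GRing.Theory Num.Theory.
Import numFieldNormedType.Exports.
Local Open Scope classical_set_scope.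
Local Open Scope ring_scope.

Set Implicit Arguments.
Unset Strict Implicit.
Unset Printing Implicit Defensive.

(** Compare [u] with its truncation [min (u, k)] in [Om]; write [w] for the
    overshoot [u - k] on the part of [Om] where [u > k].  By convexity of
    [calG], truncating lowers the energy of each pair (x, y) with [u x > k],
    [u y <= k - d] and [|x - y| <= rho <= d] by at least
    [gam * rho ^ - (n + s) * w x], since the slope there is at least 1.  It can
    only raise the energy of the pairs with [y] outside [Om] and [u y > k]; such
    [y] lie at distance at least [d] from [Om], so, [calG] being Lipschitz, the
    loss is at most a constant times [d ^ - s * w x] after integration in [y].
    If around a.e. [x] with [u x > k] there is enough room where [u <= k - d],
    the gain exceeds the loss and minimality forces [w = 0].

    With [rho] a small multiple of [d] and [k] large there is enough room since
    [u] is integrable: this gives the boundedness.  With [k - d] the maximum in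
    the statement, [x] is within [theta * d] of the boundary, and a corkscrew
    ball in the complement provides the room when [theta] is small. *)

(** Scaling decides the constants. The room for the gain has measure of order rho^n, so the gain per
    unit of overshoot is of order rho^-s, against a loss of order d^-s. With rho = t d the
    comparison no longer involves d, so a small t, and with it theta, can be fixed before u and d.
    Since d may be arbitrarily large, the corkscrew balls must be available at every scale, not only
    at small ones. The truncated difference quotient is at least d / rho >= 1 when the level k is d
    above the low values: this is the origin of the summand d in the estimate. The positive and
    negative parts of the energy difference are bounded separately by multiples of the integral of
    w. This integral is finite because u is integrable on the bounded set Om, so it can be
    cancelled. Only upper bounds are proved directly; the lower ones come from -u, which is again a
    minimizer because [calG] is even. *)

(** * Oriented primitives of continuous functions *)

Section primitives.
Context {R : realType}.
Implicit Types (f g : R -> R) (a b t m : R).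
Notation mu := (@lebesgue_measure R).

Lemma continuous_segment_integrable f a b :
  continuous f -> mu.-integrable `[a, b] (EFin \o f).
Proof.
move=> cf; apply: continuous_compact_integrable; first exact: segment_compact.
exact: continuous_subspaceT.
Qed.

Lemma primitive0B f a b : continuous f -> 0 <= a -> a <= b ->
  primitive0 f b - primitive0 f a = \int[mu]_(t in `[a, b]) f t.
Proof.
move=> cf a0 ab; rewrite /primitive0 a0 (le_trans a0 ab).
rewrite Rintegral_itvB ?bnd_simp//; last exact: continuous_segment_integrable.
rewrite Rintegral_itv_obnd_cbnd//.
apply: integrableS (continuous_segment_integrable a b cf) => //.
exact: subset_itv_oc_cc.
Qed.

Lemma primitive0_0 f : primitive0 f 0 = 0.
Proof. by rewrite /primitive0 lexx set_itv1 Rintegral_set1. Qed.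

Lemma Rintegral_itv_cst m a b : a <= b -> \int[mu]_(_ in `[a, b]) m = m * (b - a).
Proof.
move=> ab; rewrite Rintegral_cst//; congr (_ * _).
rewrite [X in fine X](_ : _ = lebesgue_measure (`[a, b] : set R))//.
rewrite lebesgue_measure_itv/= lte_fin; case: ltgtP ab => //= ab _.
by rewrite ab subrr.
Qed.

Lemma primitive0B_ge f m a b : continuous f -> 0 <= a -> a <= b ->
  (forall t, a <= t <= b -> m <= f t) ->
  m * (b - a) <= primitive0 f b - primitive0 f a.
Proof.
move=> cf a0 ab mf; rewrite primitive0B// -Rintegral_itv_cst//.
apply: le_Rintegral => //.
- exact: (continuous_segment_integrable a b (fun x => @cst_continuous _ _ m x)).
- exact: continuous_segment_integrable.
Qed.

Lemma primitive0B_le f m a b : continuous f -> 0 <= a -> a <= b ->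
  (forall t, a <= t <= b -> f t <= m) ->
  primitive0 f b - primitive0 f a <= m * (b - a).
Proof.
move=> cf a0 ab mf; rewrite primitive0B// -Rintegral_itv_cst//.
apply: le_Rintegral => //.
- exact: continuous_segment_integrable.
- exact: (continuous_segment_integrable a b (fun x => @cst_continuous _ _ m x)).
Qed.

Lemma Rintegral_itv_oppr f a b : continuous f -> a <= b ->
  \int[mu]_(t in `[- b, - a]) f t = \int[mu]_(t in `[a, b]) f (- t).
Proof.
move=> cf ab; rewrite /Rintegral.
by rewrite integration_by_substitution_oppr//; exact: continuous_subspaceT.
Qed.

(** No parity is assumed of [f]: the lemma serves for the even [g], whose primitive is odd, and for
    that odd primitive, whose own primitive [calG g] is even. *)
Lemma primitive0N f t : continuous f ->
  primitive0 f (- t) = - primitive0 (f \o -%R) t.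
Proof.
move=> cf; have cfN : continuous (f \o -%R).
  by move=> x; apply: continuous_comp; [exact: opp_continuous|exact: cf].
have [->|t0] := eqVneq t 0; first by rewrite oppr0 !primitive0_0 oppr0.
have [t_gt0|] := ltP 0 t.
  rewrite /primitive0 oppr_ge0 (ltW t_gt0) leNgt t_gt0/=; congr (- _).
  by rewrite -{1}oppr0 Rintegral_itv_oppr// ltW.
rewrite le_eqVlt (negbTE t0)/= => t_lt0.
rewrite /primitive0 oppr_ge0 (ltW t_lt0) leNgt t_lt0/= opprK.
by rewrite -{1}oppr0 Rintegral_itv_oppr// ltW.
Qed.

End primitives.

(** * Parity and linear growth of [calG] *)

Section growth_of_calG.
Context {R : realType}.
Variable g : R -> R.
Hypothesis g_range : forall t, 0 < g t <= 1.
Hypothesis g_even : forall t, g (- t) = g t.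
Hypothesis g_continuous : continuous g.
Notation mu := (@lebesgue_measure R).
Hypothesis g_moment : (\int[mu]_t (g t * `|t|)%:E < +oo)%E.
Let G := primitive0 g.

Lemma primitive0_odd t : G (- t) = - G t.
Proof.
rewrite /G primitive0N//; congr (- primitive0 _ _).
by apply/funext => x /=; exact: g_even.
Qed.

Lemma primitive0_homo a b : a <= b -> G a <= G b.
Proof.
have H (x y : R) : 0 <= x -> x <= y -> G x <= G y.
  move=> x0 xy; rewrite -subr_ge0 -(mul0r (y - x)).
  by apply: primitive0B_ge => // t _; rewrite ltW//; case/andP: (g_range t).
have H0 (x : R) : 0 <= x -> 0 <= G x.
  by move=> x0; rewrite -(primitive0_0 g); exact: H.
move=> ab; have [a0|a0] := leP 0 a; first exact: H.
have [b0|b0] := leP 0 b.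
  apply: (@le_trans _ _ 0); last exact: H0.
  by rewrite -(opprK a) primitive0_odd oppr_le0 H0// oppr_ge0 ltW.
rewrite -(opprK a) -(opprK b) !(primitive0_odd (- _)) lerN2.
by apply: H; rewrite ?lerN2// oppr_ge0 ltW.
Qed.

Lemma primitive0_lip a b : a <= b -> G b - G a <= b - a.
Proof.
have H (x y : R) : 0 <= x -> x <= y -> G y - G x <= y - x.
  move=> x0 xy; rewrite -(mul1r (y - x)).
  by apply: primitive0B_le => // t _; case/andP: (g_range t).
have H0 (x : R) : 0 <= x -> G x <= x.
  by move=> x0; have := H 0 x (lexx _) x0; rewrite {2}/G primitive0_0 !subr0.
move=> ab; have [a0|a0] := leP 0 a; first exact: H.
have GN x : G x = - G (- x) by rewrite primitive0_odd opprK.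
have [b0|b0] := leP 0 b.
  by rewrite (GN a) opprK lerD// H0// oppr_ge0 ltW.
rewrite (GN a) (GN b) opprK addrC.
have -> : b - a = - a - - b by rewrite opprK addrC.
by apply: H; rewrite ?lerN2// oppr_ge0 ltW.
Qed.

Lemma primitive0_continuous : continuous G.
Proof.
have lip x y : `|G x - G y| <= `|x - y|.
  have [xy|/ltW yx] := leP x y.
    rewrite distrC (distrC x) !ger0_norm ?subr_ge0 ?primitive0_homo//.
    exact: primitive0_lip.
  rewrite !ger0_norm ?subr_ge0 ?primitive0_homo//.
  exact: primitive0_lip.
move=> x; apply/cvgrPdist_lt => e e0.
near=> y.
apply: le_lt_trans (lip x y) _; near: y.
by apply: (@cvgr_dist_lt _ _ _ (nbhs x) _ id x).
Unshelve. all: by end_near. Qed.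

(** Beyond 1 the weight [|t|] is at least 1, so the moment of [g] dominates the growth of [G] there,
    while [G 1 <= 1] because [g <= 1]. The bound becomes the Lipschitz constant of [calG g]. *)
Lemma primitive0_bounded : exists2 L, 0 < L & forall t, `|G t| <= L.
Proof.
pose I := fine (\int[mu]_t (g t * `|t|)%:E).
have I0 : 0 <= I.
  apply: fine_ge0; apply: integral_ge0 => t _; rewrite lee_fin mulr_ge0//.
  by rewrite ltW//; case/andP: (g_range t).
have cgn : continuous (fun t => g t * `|t|).
  by move=> t; apply: continuousM; [exact: g_continuous|exact: norm_continuous].
have G0 : G 0 = 0 by exact: primitive0_0.
have Gle t : 0 <= t -> G t <= 1 + I.
  move=> t0; have [t1|/ltW t1] := leP t 1.
    apply: (@le_trans _ _ 1); last by rewrite lerDl.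
    by apply: le_trans t1; have := primitive0_lip t0; rewrite G0 !subr0.
  have G1 : G 1 <= 1 by have := primitive0_lip ler01; rewrite G0 !subr0.
  rewrite -(subrK (G 1) (G t)) addrC lerD//.
  rewrite primitive0B//.
  apply: (@le_trans _ _ (\int[mu]_(x in `[1, t]) (g x * `|x|))).
    apply: le_Rintegral => //; [exact: continuous_segment_integrable..|].
    move=> x /=; rewrite in_itv/= => /andP[x1 _].
    rewrite ler_peMr//; last by rewrite (le_trans x1)// ler_norm.
    by rewrite ltW//; case/andP: (g_range x).
  rewrite /Rintegral fine_le//.
  - exact/integrable_fin_num/continuous_segment_integrable.
  - rewrite ge0_fin_numE//; apply: integral_ge0 => x _; rewrite lee_fin mulr_ge0//.
    by rewrite ltW//; case/andP: (g_range x).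
  - apply: ge0_subset_integral => //.
      apply/measurable_EFinP; exact: continuous_measurable_fun.
    move=> x _; rewrite lee_fin mulr_ge0//.
    by rewrite ltW//; case/andP: (g_range x).
exists (1 + I); first by rewrite ltr_pwDl.
move=> t; have G_ge0 x : 0 <= x -> 0 <= G x.
  by move=> x0; rewrite -G0; exact: primitive0_homo.
have [t0|/ltW t0] := leP 0 t; first by rewrite ger0_norm ?G_ge0 ?Gle.
rewrite -(opprK t) primitive0_odd normrN.
by rewrite ger0_norm ?G_ge0 ?Gle ?oppr_ge0.
Qed.

(** The slope of [calG g] at t is [G t]: on t >= 0 it lies between 0 and the bound of [G], and
    beyond 1 it is at least [gam = G 1] by monotonicity. The energy estimates use [g] through these
    properties only. *)
Lemma calG_growth : exists L gam : R,
  [/\ 0 < L /\ 0 < gam,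
      forall t, calG g t = calG g `|t|,
      calG g 0 = 0,
      forall a b, 0 <= a -> a <= b ->
        0 <= calG g b - calG g a <= L * (b - a) &
      forall a b, 1 <= a -> a <= b -> gam * (b - a) <= calG g b - calG g a].
Proof.
have [L L0 GL] := primitive0_bounded.
have G0 : G 0 = 0 by exact: primitive0_0.
have cG := primitive0_continuous.
exists L, (G 1); split.
- split=> //.
  (* [G 1] is positive because the continuous positive [g] has a positive minimum on [0, 1]. *)
  have [c c01 cmin] : exists2 c, c \in `[0, 1] & forall t, t \in `[0,1] -> g c <= g t.
    by apply: EVT_min => //; exact: continuous_subspaceT.
  have := @primitive0B_ge _ g (g c) 0 1 g_continuous (lexx _) ler01.
  rewrite -/G G0 !subr0 mulr1 => H; apply: lt_le_trans (H _).
    by case/andP: (g_range c).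
  by move=> t t01; apply: cmin; rewrite in_itv.
- move=> t; case: (ler0P t) => // t0.
  rewrite /calG -{1}(opprK t) primitive0N// -/G.
  have -> : G \o -%R = (fun x => - G x).
    by apply/funext => x /=; exact: primitive0_odd.
  have [<-|tN0] := eqVneq 0 t; first by rewrite oppr0 !primitive0_0 oppr0.
  rewrite /primitive0 oppr_ge0 t0.
  rewrite -[LHS]mulN1r -RintegralZl//; last first.
    apply: continuous_segment_integrable => x.
    by apply: continuousN; exact: cG.
  by apply: eq_Rintegral => x _; rewrite mulN1r opprK.
- exact: primitive0_0.
- move=> a b a0 ab; apply/andP; split.
    rewrite -(mul0r (b - a)); apply: primitive0B_ge => // t /andP[at_ _].
    by rewrite -G0; apply: primitive0_homo; exact: le_trans at_.
  apply: primitive0B_le => // t _.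
  by apply: le_trans (GL t); exact: ler_norm.
- move=> a b a1 ab; apply: primitive0B_ge => //.
    by rewrite (le_trans _ a1).
  by move=> t /andP[at_ _]; apply: primitive0_homo; exact: le_trans at_.
Qed.

End growth_of_calG.

(** * Volume of cubes and measurability of open sets in R^n *)

Section lebesgue_cubes.
Context {R : realType}.
Local Notation T := (measurableTypeR R).

Definition tuple_of_rV n (x : 'rV[R]_n) : n.-tuple T := [tuple x ord0 i | i < n].

Lemma rV_of_tupleK n : cancel (@rV_of_tuple R n) (@tuple_of_rV n).
Proof. by move=> t; apply: eq_from_tnth => i; rewrite tnth_mktuple mxE. Qed.

Lemma preimage_tuple_of_rV n (A : set (n.-tuple T)) :
  @rV_of_tuple R n @^-1` (@tuple_of_rV n @^-1` A) = A.
Proof. by apply/seteqP; split=> t /=; rewrite rV_of_tupleK. Qed.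

(** Measurable sets of tuples satisfy Caratheodory's criterion for the outer extension of
    [lebesgue_tuple]; pulling the test set back along [rV_of_tuple] gives the criterion that defines
    measurability in [Rn]. *)
Lemma measurable_preimage_tuple_of_rV n (A : set (n.-tuple T)) :
  measurable A -> measurable (@tuple_of_rV n @^-1` A : set (Rn R n)).
Proof.
move=> mA; change (caratheodory_measurable (@lebesgue_outer R n)
  (@tuple_of_rV n @^-1` A)) => X.
have := caratheodory_measurable_mu_ext (lebesgue_tuple n) mA.
move=> /(_ (@rV_of_tuple R n @^-1` X)) E.
by rewrite /= /lebesgue_outer !preimage_setI -preimage_setC preimage_tuple_of_rV.
Qed.

Lemma lebesgue_preimage_tuple_of_rV n (A : set (n.-tuple T)) : measurable A ->
  lebesgue n (@tuple_of_rV n @^-1` A : set (Rn R n)) = lebesgue_tuple n A.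
Proof.
move=> mA; rewrite /lebesgue/= /lebesgue_outer preimage_tuple_of_rV.
by rewrite (measurable_mu_extE (lebesgue_tuple n) mA).
Qed.

Lemma measurable_coord n (i : 'I_n) :
  measurable_fun setT (fun x : Rn R n => (x : 'rV[R]_n) ord0 i : T).
Proof.
move=> _ B mB; rewrite setTI.
have mE : measurable ((fun t : n.-tuple T => tnth t i) @^-1` B).
  by rewrite -[X in measurable X]setTI; exact: measurable_tnth.
rewrite (_ : _ @^-1` B = @tuple_of_rV n @^-1` ((fun t => tnth t i) @^-1` B)).
  exact: measurable_preimage_tuple_of_rV.
by apply/seteqP; split=> x /=; rewrite tnth_mktuple.
Qed.

Definition tuple_box n (a : 'I_n -> R) (l : R) : set (n.-tuple T) :=
  [set t | forall i, a i <= tnth t i <= a i + l].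

Lemma measurable_tuple_box n (a : 'I_n -> R) l : measurable (tuple_box a l).
Proof.
rewrite (_ : tuple_box a l = \bigcap_(i in [set: 'I_n])
    ((fun t : n.-tuple T => tnth t i) @^-1` `[a i, a i + l]%classic)).
  apply: fin_bigcap_measurable; first exact: finite_finset.
  move=> i _; rewrite -[X in measurable X]setTI.
  by apply: measurable_tnth => //; exact: measurable_itv.
apply/seteqP; split=> t /= H i; last by have := H i I; rewrite /= in_itv.
by move=> _; rewrite /= in_itv/=; exact: H.
Qed.

Lemma lebesgue_tuple_box n (a : 'I_n -> R) l : 0 <= l ->
  lebesgue_tuple n (tuple_box a l) = (l ^+ n)%:E.
Proof.
move=> l0; elim: n a => [|n IH] a.
  by rewrite /= expr0 diracE mem_set// => -[].
have E : @tuple_cons R n @^-1` tuple_box a l =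
    `[a ord0, a ord0 + l]%classic `*` tuple_box (a \o lift ord0) l.
  apply/seteqP; split=> -[x t]/=.
    move=> H; split=> /=; first by have := H ord0; rewrite in_itv/= tnth0.
    by move=> i; have := H (lift ord0 i); rewrite tnthS.
  move=> [/=]; rewrite in_itv/= => x0 H i.
  by case: (unliftP ord0 i) => [j ->|->]; rewrite ?tnthS ?tnth0//; exact: H.
rewrite [LHS](_ : _ = product_measure1 (@lebesgue_measure R)
   (@lebesgue_tuple R n) (@tuple_cons R n @^-1` tuple_box a l))// E.
rewrite product_measure1E//; last exact: measurable_tuple_box.
rewrite exprS EFinM; congr (_ * _)%E; last exact: IH.
rewrite [LHS](_ : _ = lebesgue_measure (`[a ord0, a ord0 + l] : set R))//.
rewrite lebesgue_measure_itv/= lte_fin ltrDl.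
case: ltgtP l0 => // [l0|<-] _; last by [].
by rewrite -EFinB addrC addKr.
Qed.

(** Stands in for Euclidean balls in all volume estimates: its measure is explicit, and [enorm_cube]
    and [cube_enorm] compare the two up to a factor n. *)
Definition cube n (x : 'rV[R]_n) (r : R) : set (Rn R n) :=
  [set y : 'rV[R]_n | forall i, `|x ord0 i - y ord0 i| <= r].

Lemma cubeE n (x : 'rV[R]_n) r :
  cube x r = @tuple_of_rV n @^-1` tuple_box (fun i => x ord0 i - r) (2 * r).
Proof.
apply/seteqP; split=> y /= H i; have := H i; rewrite tnth_mktuple ler_norml; lra.
Qed.

Lemma measurable_cube n (x : 'rV[R]_n) r : measurable (cube x r).
Proof.
by rewrite cubeE; apply: measurable_preimage_tuple_of_rV; exact: measurable_tuple_box.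
Qed.

Lemma lebesgue_cube n (x : 'rV[R]_n) r : 0 <= r ->
  lebesgue n (cube x r) = ((2 * r) ^+ n)%:E.
Proof.
move=> r0; rewrite cubeE lebesgue_preimage_tuple_of_rV ?lebesgue_tuple_box//.
  by rewrite mulr_ge0.
exact: measurable_tuple_box.
Qed.

(** An open set is the union of those cubes with rational centre and radius 1/(m+1) that it
    contains, and there are countably many of them. *)
Lemma open_measurable_Rn n (A : set 'rV[R]_n) :
  open A -> measurable (A : set (Rn R n)).
Proof.
move=> oA.
pose F (p : 'rV[rat]_n * nat) : set (Rn R n) :=
  [set y | cube (map_mx ratr p.1) p.2.+1%:R^-1 `<=` A /\
           cube (map_mx ratr p.1) p.2.+1%:R^-1 y].
rewrite (_ : A = \bigcup_p F p).
  apply: countable_bigcupT_measurable => [|p].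
    exact/countableP.
  rewrite /F; have [H|H] := pselect (cube (map_mx ratr p.1) p.2.+1%:R^-1 `<=` A).
    rewrite (_ : [set _ | _] = cube (map_mx ratr p.1) p.2.+1%:R^-1).
      exact: measurable_cube.
    by apply/seteqP; split=> y //= -[].
  by rewrite (_ : [set _ | _] = set0)//; apply/seteqP; split=> y //= -[].
apply/seteqP; split=> [x Ax|x [p _ [H]]]; last exact: H.
have : nbhs (x : 'rV[R]_n) A by exact: open_nbhs_nbhs.
move=> /nbhs_ballP[e /= e0 eA].
(* Half of [e] is spent on the distance from x to the rational centre, half on the radius of the
   cube. *)
have [m me] : exists m : nat, m.+1%:R^-1 < e / 2.
  have e20 : 0 < e / 2 by rewrite divr_gt0.
  near \oo => m; exists m; near: m; exact: near_infty_natSinv_lt (PosNum e20).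
have q_ i : {q : rat | `|(x : 'rV[R]_n) ord0 i - ratr q| < m.+1%:R^-1}.
  apply/cid; have : (x : 'rV[R]_n) ord0 i - m.+1%:R^-1 < (x : 'rV[R]_n) ord0 i + m.+1%:R^-1.
    by rewrite ltrD2l gtrN.
  move=> /rat_in_itvoo[q]; rewrite in_itv/= => /andP[H1 H2]; exists q.
  by rewrite distrC ltr_distl H1.
exists (\row_i projT1 (q_ i), m) => //; split=> [y Fy|i] /=.
  apply: eA; split=> // i j; rewrite ord1 /ball/=.
  have := Fy j; rewrite !mxE/=; have := projT2 (q_ j) => H1 H2.
  rewrite (splitr e) (le_lt_trans (ler_distD (ratr (projT1 (q_ j))) _ _))//.
  by rewrite ltrD ?(lt_trans H1)// (le_lt_trans H2).
by rewrite !mxE distrC ltW//; exact: (projT2 (q_ i)).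
Unshelve. all: by end_near. Qed.

End lebesgue_cubes.

(** * The Euclidean norm and its comparison with the sup norm *)

Section euclidean_norm.
Context {R : realType} {n : nat}.
Implicit Types (x y z e : 'rV[R]_n) (a r : R).

Lemma dotrC x y : dotr x y = dotr y x.
Proof. by apply: eq_bigr => i _; rewrite mulrC. Qed.

Lemma dotrDl x y z : dotr (x + y) z = dotr x z + dotr y z.
Proof. by rewrite /dotr -big_split; apply: eq_bigr => i _; rewrite mxE mulrDl. Qed.

Lemma dotrZl a x y : dotr (a *: x) y = a * dotr x y.
Proof. by rewrite /dotr mulr_sumr; apply: eq_bigr => i _; rewrite mxE mulrA. Qed.

Lemma dotrNl x y : dotr (- x) y = - dotr x y.
Proof. by rewrite -scaleN1r dotrZl mulN1r. Qed.

Lemma dotrBl x y z : dotr (x - y) z = dotr x z - dotr y z.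
Proof. by rewrite dotrDl dotrNl. Qed.

Lemma dotrDr x y z : dotr x (y + z) = dotr x y + dotr x z.
Proof. by rewrite !(dotrC x) dotrDl. Qed.

Lemma dotrZr a x y : dotr x (a *: y) = a * dotr x y.
Proof. by rewrite !(dotrC x) dotrZl. Qed.

Lemma dotrBr x y z : dotr x (y - z) = dotr x y - dotr x z.
Proof. by rewrite !(dotrC x) dotrBl. Qed.

Lemma dotr_ge0 x : 0 <= dotr x x.
Proof. by apply: sumr_ge0 => i _; rewrite -expr2 sqr_ge0. Qed.

Lemma enorm_ge0 x : 0 <= enorm x.
Proof. exact: sqrtr_ge0. Qed.

Lemma enorm_sqr x : enorm x ^+ 2 = dotr x x.
Proof. by rewrite sqr_sqrtr// dotr_ge0. Qed.

(** For y <> 0, expanding the square norm of <y,y> x - <x,y> y gives <y,y> (<x,x> <y,y> - <x,y>^2)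
    >= 0. *)
Lemma cauchy_schwarz x y : `|dotr x y| <= enorm x * enorm y.
Proof.
rewrite -(@ler_pXn2r _ 2%N) ?nnegrE// ?mulr_ge0 ?enorm_ge0//.
rewrite real_normK ?num_real// exprMn !enorm_sqr.
have [y0|y0] := eqVneq (dotr y y) 0.
  suff -> : dotr x y = 0 by rewrite y0 mulr0 expr0n.
  move/eqP: y0; rewrite psumr_eq0 => [/allP y0|i _]; last first.
    by rewrite -expr2 sqr_ge0.
  rewrite /dotr big1// => i _; have := y0 i; rewrite mem_index_enum => /(_ isT).
  by rewrite mulf_eq0 orbb => /eqP ->; rewrite mulr0.
have := dotr_ge0 (dotr y y *: x - dotr x y *: y).
rewrite !(dotrBl, dotrBr, dotrZl, dotrZr) (dotrC y x).
set A := dotr x x; set B := dotr y y; set C := dotr x y => H.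
have B0 : 0 < B by rewrite lt_def y0 dotr_ge0.
by rewrite -(ler_pM2l B0); nra.
Qed.

Lemma enormD x y : enorm (x + y) <= enorm x + enorm y.
Proof.
rewrite -(@ler_pXn2r _ 2%N) ?nnegrE ?addr_ge0 ?enorm_ge0//.
rewrite enorm_sqr dotrDl !dotrDr -!enorm_sqr (dotrC y x).
have := cauchy_schwarz x y; have := ler_norm (dotr x y); nra.
Qed.

Lemma enormN x : enorm (- x) = enorm x.
Proof. by rewrite /enorm dotrNl dotrC dotrNl opprK. Qed.

Lemma enormZ a x : enorm (a *: x) = `|a| * enorm x.
Proof.
by rewrite /enorm dotrZl dotrZr mulrA -expr2 sqrtrM ?sqr_ge0// sqrtr_sqr.
Qed.

Lemma enormB x y : enorm (x - y) = enorm (y - x).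
Proof. by rewrite -enormN opprB. Qed.

Lemma enorm_triangle z x y : enorm (x - y) <= enorm (x - z) + enorm (z - y).
Proof. by apply: le_trans (enormD _ _); rewrite addrA subrK. Qed.

Lemma enorm0 : enorm (0 : 'rV[R]_n) = 0.
Proof. by rewrite -(scale0r 0) enormZ normr0 mul0r. Qed.

Lemma coord_le_enorm x i : `|x ord0 i| <= enorm x.
Proof.
rewrite -(@ler_pXn2r _ 2%N) ?nnegrE ?enorm_ge0// real_normK ?num_real//.
rewrite enorm_sqr /dotr (bigD1 i)//= -expr2 lerDl.
by apply: sumr_ge0 => j _; rewrite -expr2 sqr_ge0.
Qed.

Lemma enorm_eq0 x : (enorm x == 0) = (x == 0).
Proof.
apply/eqP/eqP => [x0|->]; last exact: enorm0.
apply/rowP => i; rewrite mxE; apply/eqP; rewrite -normr_le0 -x0.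
exact: coord_le_enorm.
Qed.

Lemma enorm_le_cube x r : (forall i, `|x ord0 i| <= r) -> enorm x <= n%:R * r.
Proof.
move=> H; have [i0|] := pickP (fun _ : 'I_n => true); last first.
  (* Without coordinates [r] may be negative, but both sides are 0. *)
  move=> /= n0; rewrite (_ : enorm x = 0).
    by case: {+}n x H n0 => [|m] x H n0; [rewrite mul0r|have := n0 ord0].
  by rewrite /enorm /dotr big1 ?sqrtr0// => i; have := n0 i.
move=> _; have r0 : 0 <= r by apply: le_trans (H i0).
rewrite -(@ler_pXn2r _ 2%N) ?nnegrE ?enorm_ge0 ?mulr_ge0//.
rewrite enorm_sqr; apply: (@le_trans _ _ (\sum_(i < n) r ^+ 2)).
  apply: ler_sum => i _; rewrite -expr2 -(real_normK (num_real _)).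
  by rewrite ler_pXn2r ?nnegrE.
rewrite sumr_const card_ord -[leLHS]mulr_natl exprMn ler_wpM2r ?sqr_ge0//.
by rewrite -natrX ler_nat; case: {+}n => // m; rewrite expnS expn1 leq_pmulr.
Qed.

Lemma enorm_cube x y r : enorm (x - y) <= r -> cube x r y.
Proof.
move=> xy i; apply: le_trans xy; have := coord_le_enorm (x - y) i.
by rewrite !mxE.
Qed.

Lemma cube_enorm x y r : cube x r y -> enorm (x - y) <= n%:R * r.
Proof. by move=> H; apply: enorm_le_cube => i; have := H i; rewrite !mxE. Qed.

Lemma enorm_orthogonal_le e x : enorm e = 1 -> enorm (x - dotr x e *: e) <= enorm x.
Proof.
move=> e1; rewrite ler_sqrt ?dotr_ge0//.
rewrite !(dotrBl, dotrBr, dotrZl, dotrZr) (dotrC e x) -(enorm_sqr e) e1.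
by have := sqr_ge0 (dotr x e); lra.
Qed.

Lemma measurable_enormB :
  measurable_fun setT (fun z : Rn R n * Rn R n =>
    enorm ((z.1 : 'rV[R]_n) - (z.2 : 'rV[R]_n))).
Proof.
rewrite (_ : (fun _ => _) = Num.sqrt \o (fun z : Rn R n * Rn R n =>
    \sum_i ((z.1 : 'rV[R]_n) - (z.2 : 'rV[R]_n)) ord0 i *
            ((z.1 : 'rV[R]_n) - (z.2 : 'rV[R]_n)) ord0 i))//.
apply: measurableT_comp.
  by apply: continuous_measurable_fun; exact: sqrt_continuous.
apply: measurable_sum => i.
have mB : measurable_fun setT (fun z : Rn R n * Rn R n =>
    ((z.1 : 'rV[R]_n) - (z.2 : 'rV[R]_n)) ord0 i).
  rewrite (_ : (fun _ => _) = (fun z : Rn R n * Rn R n =>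
      (z.1 : 'rV[R]_n) ord0 i - (z.2 : 'rV[R]_n) ord0 i)).
    apply: measurable_funB.
      by apply: (measurableT_comp (measurable_coord i)).
    by apply: (measurableT_comp (measurable_coord i)).
  by apply/funext => z; rewrite !mxE.
exact: measurable_funM.
Qed.

End euclidean_norm.

(** * Tail integrals of the kernel |x - y|^-(n+s) *)

(** Contribution of the shell 2^j d <= |x - y| < 2^(j+1) d: the kernel is at most its value at the
    inner radius, and the shell lies in the cube whose half-side is the outer radius. What remains
    is d^-s and the j-th term of a geometric series. *)
Lemma dyadic_shell_term {R : realType} (n j : nat) (s d : R) : 0 < d ->
  ((2 ^+ j * d) `^ (n%:R + s))^-1 * (2 * (2 ^+ j.+1 * d)) ^+ n =
  4 ^+ n * (d `^ s)^-1 * ((2 `^ s)^-1) ^+ j.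
Proof.
move=> d0; have r0 : 0 < 2 ^+ j * d by rewrite mulr_gt0// exprn_gt0.
rewrite powRD; last by rewrite (gt_eqF r0) implybT.
rewrite powR_mulrn; last exact: ltW.
have -> : (2 ^+ j * d) `^ s = d `^ s * (2 `^ s) ^+ j.
  rewrite powRM ?exprn_ge0 ?(ltW d0)// mulrC; congr (_ * _).
  by rewrite -powR_mulrn// -powRrM mulrC powRrM powR_mulrn// powR_ge0.
have -> : 2 * (2 ^+ j.+1 * d) = 4 * (2 ^+ j * d) by rewrite exprS; ring.
rewrite (exprMn _ 4) exprVn !invfM.
have : (2 ^+ j * d) ^+ n != 0 by rewrite expf_neq0// gt_eqF.
move: ((2 ^+ j * d) ^+ n) (d `^ s)^-1 ((2 `^ s) ^+ j)^-1 (4 ^+ n) => t a b c t0.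
by field.
Qed.

Section tail.
Context {R : realType} {n : nat}.
Implicit Types (x y : 'rV[R]_n).
Local Open Scope ereal_scope.

Lemma measurable_enormB_section x :
  measurable_fun setT (fun y : Rn R n => enorm (x - y)).
Proof.
exact: (measurableT_comp measurable_enormB (measurable_pair1 (x : Rn R n))).
Qed.

(** The exponent is free because, besides n + s, the exponents 1 and n - 1 + s occur in the
    measurability of the energy difference. *)
Definition rkernel (p : R) x y : R := ((enorm (x - y) `^ p)^-1)%R.

Lemma rkernel_ge0 p x y : (0 <= rkernel p x y)%R.
Proof. by rewrite invr_ge0 powR_ge0. Qed.

Lemma measurable_rkernel (p : R) :
  measurable_fun setT (fun z : Rn R n * Rn R n => rkernel p z.1 z.2).
Proof.
rewrite /rkernel; under eq_fun do rewrite -powRN.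
exact: (measurableT_comp (@measurable_powR R _) measurable_enormB).
Qed.

Lemma measurable_rkernel_section (p : R) x :
  measurable_fun setT (fun y : Rn R n => rkernel p x y).
Proof.
exact: (measurableT_comp (measurable_rkernel p) (measurable_pair1 (x : Rn R n))).
Qed.

Lemma dyadic_shell (d t : R) : (0 < d)%R -> (d <= t)%R ->
  exists j : nat, (2 ^+ j * d <= t < 2 ^+ j.+1 * d)%R.
Proof.
move=> d0 dt.
have [m tm] : exists m : nat, (t < 2 ^+ m * d)%R.
  exists (Num.truncn (t / d)).+1.
  rewrite -ltr_pdivrMr//; apply: lt_trans (_ : (Num.truncn (t / d)).+1%:R < _)%R.
    by apply: truncnS_gt; rewrite divr_ge0 ?(ltW d0)// (le_trans _ dt)// ltW.
  by rewrite -natrX ltr_nat ltn_expl.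
have [[|j] tj minj] := ex_minnP (ex_intro (fun m => (t < 2 ^+ m * d)%R) m tm).
  by move: tj; rewrite expr0 mul1r ltNge dt.
exists j; rewrite tj andbT leNgt; apply/negP => H.
by have := minj _ H; rewrite ltnn.
Qed.

(** Summing over dyadic shells gives a geometric series of ratio 2^-s < 1, so the constant is 4^n /
    (1 - 2^-s) for all x and d. *)
Lemma tail_integral (s : R) : (0 < s)%R ->
  exists2 C : R, (0 < C)%R & forall x (d : R), (0 < d)%R ->
    \int[lebesgue n]_(y in [set y | (d <= enorm (x - (y : 'rV[R]_n)))%R])
      (rkernel (n%:R + s) x y)%:E <= (C * (d `^ s)^-1)%:E.
Proof.
move=> s0; pose q : R := ((2 `^ s)^-1)%R.
have q0 : (0 < q)%R by rewrite invr_gt0 powR_gt0.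
have q1 : (q < 1)%R.
  rewrite invf_lt1 ?powR_gt0//.
  have : (1 `^ s < 2 `^ s :> R)%R.
    by apply: gt0_ltr_powR; rewrite // ?nnegrE ?ltr1n ?ler01 ?ler0n.
  by rewrite powR1.
have n0 : (0 <= n%:R :> R)%R by [].
pose C0 : R := (4 ^+ n)%R.
have C00 : (0 < C0)%R by rewrite exprn_gt0.
exists (C0 / (1 - q))%R; first by rewrite divr_gt0// subr_gt0.
move=> x d d0.
pose p : R := (n%:R + s)%R.
have p0 : (0 <= p)%R by rewrite addr_ge0// ltW.
pose r j : R := (2 ^+ j * d)%R.
have r0 j : (0 < r j)%R by rewrite mulr_gt0// exprn_gt0.
pose f j (y : Rn R n) : \bar R :=
  (((r j) `^ p)^-1)%:E * (\1_(cube x (r j.+1)) y)%:E.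
have mf j : measurable_fun setT (f j).
  apply: measurable_funeM; apply/measurable_EFinP.
  by apply: measurable_indic; exact: measurable_cube.
have f0 j y : 0 <= f j y by rewrite mule_ge0// lee_fin ?invr_ge0 ?powR_ge0.
rewrite integral_mkcond.
(* The terms live on whole cubes, which overlap; a single term already dominates the kernel at a
   point of its shell. *)
apply: (@le_trans _ _ (\int[lebesgue n]_y \sum_(0 <= j <oo) f j y)).
  apply: ge0_le_integral.
  - exact: measurableT.
  - by move=> y _; apply: erestrict_ge0 => z _; rewrite lee_fin rkernel_ge0.
  - apply/(measurable_restrictT _ _).1; last first.
      apply/measurable_EFinP; apply: measurable_funTS.
      exact: measurable_rkernel_section.
    rewrite (_ : [set _ | _] = setT `&` (fun y : Rn R n => enorm (x - y)) @^-1`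
        `[d, +oo[%classic); last first.
      by rewrite setTI; apply/seteqP; split=> z /=; rewrite in_itv/= andbT.
    apply: measurable_enormB_section; [exact: measurableT|exact: measurable_itv].
  - by apply: ge0_emeasurable_sum.
  move=> y _; rewrite patchE; case: ifPn => [|_]; last exact: nneseries_ge0.
  rewrite inE/= => dy.
  have [j /andP[H1 H2]] := dyadic_shell d0 dy.
  apply: (@le_trans _ _ (f j y)).
    rewrite /f indicE mem_set; last by apply: enorm_cube; exact: ltW.
    have xy0 : (0 < enorm (x - y))%R by apply: lt_le_trans H1; exact: r0.
    rewrite mule1 lee_fin lef_pV2 ?posrE ?powR_gt0//.
    by rewrite ge0_ler_powR// ?nnegrE ?(ltW (r0 _))// enorm_ge0.
  apply: le_trans (nneseries_lim_ge j.+1 _) => //.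
  by rewrite big_nat_recr//= leeDr// sume_ge0.
rewrite integral_nneseries//.
have If j : \int[lebesgue n]_y f j y = (C0 * (d `^ s)^-1 * q ^+ j)%:E.
  rewrite ge0_integralZl_EFin; first last.
  - by rewrite invr_ge0 powR_ge0.
  - by apply/measurable_EFinP; apply: measurable_indic; exact: measurable_cube.
  - by move=> y _; rewrite lee_fin.
  - exact: measurableT.
  rewrite integral_indic; [|exact: measurableT|exact: measurable_cube].
  rewrite setIT [X in _ * X](_ : _ = ((2 * r j.+1) ^+ n)%:E)%R; last first.
    by apply: lebesgue_cube; exact/ltW/r0.
  rewrite -EFinM; congr EFin.
  exact: dyadic_shell_term.
rewrite (eq_eseriesr (fun j _ => If j)).
apply: lime_le.
  apply: is_cvg_nneseries => j _ _; rewrite lee_fin !mulr_ge0 ?exprn_ge0 ?(ltW q0)//.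
  by rewrite invr_ge0 powR_ge0.
apply: nearW => m; rewrite sumEFin lee_fin -mulr_sumr.
rewrite [leRHS]mulrAC ler_wpM2l ?mulr_ge0 ?invr_ge0 ?powR_ge0 ?(ltW C00)//.
rewrite -[leRHS]mul1r ler_pdivlMr ?subr_gt0// big_mkord mulrC.
by rewrite -opprB mulNr -subrX1 opprB gerBl exprn_ge0// ltW.
Qed.

End tail.

(** * Boundary points and the signed distance *)

Section signed_distance.
Context {R : realType} {n : nat}.
Implicit Types (x y z p : 'rV[R]_n) (Om : set 'rV[R]_n) (r : R).

Lemma nbhs_enorm p r : 0 < r -> nbhs p [set y : 'rV[R]_n | enorm (y - p) < r].
Proof.
(* Passing from the sup norm costs a factor n; dividing by n + 1 keeps the bound strict and covers n
   = 0. *)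
move=> r0; apply/nbhs_ballP; exists (r / n.+1%:R); first by rewrite /= divr_gt0.
move=> y [_ Hy] /=; apply: (@le_lt_trans _ _ (n%:R * (r / n.+1%:R))).
  rewrite enormB; apply: enorm_le_cube => i; rewrite !mxE ltW//.
  exact: Hy.
by rewrite mulrCA gtr_pMr// ltr_pdivrMr// mul1r ltr_nat.
Qed.

Lemma segment_continuous x y : continuous (fun t : R => x + t *: (y - x)).
Proof.
by move=> t; apply: cvgD; [exact: cvg_cst|apply: cvgZr_tmp; exact: cvg_id].
Qed.

(** The supremum of the parameters at which the segment from x to y is in [Om] gives the point: [Om]
    accumulates there, and an interior point would allow a larger parameter. *)
Lemma exists_boundary_between Om x y : Om x -> ~ Om y ->
  exists2 z, boundary Om z & enorm (z - y) <= enorm (x - y).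
Proof.
move=> Ox Oy; pose h (t : R) := x + t *: (y - x).
have ch : continuous h by exact: segment_continuous.
pose S := [set t : R | 0 <= t <= 1 /\ Om (h t)].
have S0 : S 0 by rewrite /S /h /= scale0r addr0 lexx ler01.
have supS : has_sup S by split; [exists 0|exists 1 => t [/andP[]]].
have t0 : 0 <= sup S by exact: sup_upper_bound.
have t1 : sup S <= 1 by apply: ge_sup; [exists 0|move=> t [/andP[]]].
exists (h (sup S)); last first.
  have -> : h (sup S) - y = (1 - sup S) *: (x - y).
    by apply/rowP => i; rewrite !mxE; ring.
  rewrite enormZ ler_piMl ?enorm_ge0// ger0_norm ?subr_ge0//.
  by rewrite gerBl.
split.
  move=> B /ch/nbhs_ballP[e /= e0 eB].
  have [t St tS] := sup_adherent e0 supS.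
  exists (h t); split; first by case: St.
  apply: eB; rewrite /ball/= ger0_norm ?subr_ge0 ?sup_upper_bound//.
  by rewrite ltrBlDr -ltrBlDl.
move=> /ch/nbhs_ballP[e /= e0 eB].
have [S1|S1] := eqVneq (sup S) 1.
  have := eB (sup S) (ballxx _ e0); rewrite S1 /= /h scale1r addrC subrK.
  by move=> /Oy.
have {}S1 : sup S < 1 by rewrite lt_neqAle S1.
(* Slightly past the supremum, capped so as to stay on the segment. *)
pose t := Num.min 1 (sup S + e / 2).
have St : sup S < t by rewrite lt_min S1 ltrDl divr_gt0.
suff : S t by move=> /(sup_upper_bound supS); rewrite leNgt St.
split.
  by rewrite ge_min lexx andbT (le_trans t0)// ltW.
apply: (eB t); rewrite /ball/= distrC ger0_norm ?subr_ge0 ?(ltW St)//.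
rewrite ltrBlDl gt_min ltrD2l.
by rewrite (_ : e / 2 < e) ?orbT// ltr_pdivrMr// ltr_pMr// ltr1n.
Qed.

Lemma edistance_ge0 x Om : 0 <= edistance x Om.
Proof.
(* The infimum of the empty set is 0 by convention. *)
have [[y Oy]|H] := pselect (Om !=set0); last first.
  rewrite /edistance (_ : [set _ | _ in _] = set0) ?inf0//.
  by apply/seteqP; split=> // t [y Oy _]; apply: H; exists y.
apply: lb_le_inf; first by exists (enorm (x - y)), y.
by move=> _ [z _ <-]; exact: enorm_ge0.
Qed.

Lemma edistance_le x y Om : Om y -> edistance x Om <= enorm (x - y).
Proof.
move=> Oy; apply: ge_inf; last by exists y.
by exists 0 => _ [z _ <-]; exact: enorm_ge0.
Qed.

Lemma edistance_lt x Om r : Om !=set0 -> edistance x Om < r ->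
  exists2 y, Om y & enorm (x - y) < r.
Proof.
move=> [y Oy] xr; have e0 : 0 < r - edistance x Om by rewrite subr_gt0.
have [|_ [z Oz <-] H] := inf_adherent e0 (E := [set enorm (x - y) | y in Om]).
  by split; [exists (enorm (x - y)), y|exists 0 => _ [z _ <-]; exact: enorm_ge0].
by exists z => //; move: H; rewrite -/(edistance x Om) subrKC.
Qed.

Lemma sublevel_domain_neg Om r x : r <= 0 -> sublevel_domain Om r x -> Om x.
Proof.
rewrite /sublevel_domain /signed_distance /= => r0.
case: ifPn => [/set_mem//|_ H].
by have := lt_le_trans H r0; rewrite ltNge edistance_ge0.
Qed.

Lemma sublevel_domain_pos Om r x : 0 < r -> Om x -> sublevel_domain Om r x.
Proof.
move=> r0 Ox; rewrite /sublevel_domain /signed_distance /= mem_set//.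
by rewrite (le_lt_trans _ r0)// oppr_le0 edistance_ge0.
Qed.

Lemma sublevel_domain_boundary Om r x p : 0 < r -> boundary Om p ->
  enorm (x - p) < r -> sublevel_domain Om r x.
Proof.
move=> r0 Op xp; have [|Ox] := pselect (Om x); first exact: sublevel_domain_pos.
rewrite /sublevel_domain /signed_distance /= memNset//.
exact: le_lt_trans (edistance_le _ Op) xp.
Qed.

(** If y is outside [Om], the segment from x to y crosses the boundary no farther from y than x is.
    Thus a bound on the outer layer of width d leaves the exceptional outer points at distance at
    least d from [Om]. *)
Lemma sublevel_domain_near Om r x y : Om x -> enorm (x - y) < r ->
  sublevel_domain Om r y.
Proof.
move=> Ox xy; have r0 : 0 < r by exact: le_lt_trans (enorm_ge0 _) xy.
have [|Oy] := pselect (Om y); first exact: sublevel_domain_pos.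
have [z Oz zy] := exists_boundary_between Ox Oy.
by apply: (sublevel_domain_boundary r0 Oz); rewrite enormB (le_lt_trans zy).
Qed.

(** The gap between [rho] and [r] yields an actual boundary point without an attained infimum. *)
Lemma near_boundary Om rho r x : boundary Om !=set0 -> Om x ->
  ~ sublevel_domain Om (- rho) x -> rho < r ->
  exists2 p, boundary Om p & enorm (x - p) < r.
Proof.
move=> B0 Ox; rewrite /sublevel_domain /signed_distance /= mem_set//.
move=> /negP; rewrite -leNgt lerN2 => xrho rhor.
exact/(edistance_lt B0)/(le_lt_trans xrho).
Qed.

End signed_distance.

(** * Exterior corkscrew balls for Lipschitz domains *)

Section exterior_corkscrew.
Context {R : realType} {n : nat}.
Implicit Types (x y z p e : 'rV[R]_n) (Om : set 'rV[R]_n) (r c : R).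

Definition corkscrew Om c p r :=
  exists z, forall y, enorm (y - z) <= c * r -> enorm (y - p) <= r /\ ~ Om y.

Lemma corkscrew_le Om c c' p r r' : c * r <= c' * r' -> r' <= r ->
  corkscrew Om c' p r' -> corkscrew Om c p r.
Proof.
move=> cr rr' [z zP]; exists z => y yz.
have [H1 H2] := zP y (le_trans yz cr); split=> //; exact: le_trans rr'.
Qed.

(* Below a point of the complement, a ball of radius comparable with the
   depth stays under the Lipschitz graph. *)
Lemma epigraph_corkscrew Om x0 (r0 L : R) e (psi : 'rV[R]_n -> R) p r :
  enorm e = 1 -> 0 <= L ->
  (forall y z, dotr y e = 0 -> dotr z e = 0 ->
    `|psi y - psi z| <= L * enorm (y - z)) ->
  (forall x, enorm (x - x0) < r0 -> (Om x <-> psi (x - dotr x e *: e) < dotr x e)) ->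
  0 < r -> r <= r0 / 2 -> enorm (p - x0) < r0 / 2 -> ~ Om p ->
  corkscrew Om (2 * (L + 1))^-1 p r.
Proof.
move=> e1 L0 psiL OmE r_gt0 rr0 px0 Op.
have L1 : 0 < L + 1 by rewrite ltr_wpDl.
exists (p - (r / 2) *: e) => y yz.
(* The centre lies r/2 below p. In a ball of radius [del] around it the height rises by at most
   [del] and the graph drops by at most [L * del]; together this is exactly r/2. *)
set del := (2 * (L + 1))^-1 * r in yz.
have delE : (L + 1) * del = r / 2.
  by rewrite /del invfM; field; rewrite gt_eqF.
have del0 : 0 <= del by rewrite mulr_ge0 ?invr_ge0 ?mulr_ge0// ltW.
have delr : del <= r / 2 by rewrite -delE ler_peMl// lerDr.
have yp : enorm (y - p) <= r.
  apply: le_trans (enorm_triangle (p - (r / 2) *: e) _ _) _.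
  rewrite [leRHS]splitr; apply: lerD; first exact: (le_trans yz delr).
  by rewrite addrAC subrr add0r enormN enormZ e1 mulr1 ger0_norm// divr_ge0// ltW.
split=> //.
have yx0 : enorm (y - x0) < r0.
  apply: le_lt_trans (enorm_triangle p _ _) _.
  by rewrite [ltRHS]splitr ler_ltD// (le_trans yp).
move=> /(OmE _ yx0); apply/negP; rewrite -leNgt.
have pe : dotr p e <= psi (p - dotr p e *: e).
  rewrite leNgt; apply/negP => H; apply: Op; apply/OmE => //.
  by rewrite (lt_le_trans px0)// ler_pdivrMr// ler_peMr ?ler1n// ltW// (le_lt_trans (enorm_ge0 _) yx0).
have ee : dotr e e = 1 by rewrite -enorm_sqr e1 expr1n.
have orth x : dotr (x - dotr x e *: e) e = 0 by rewrite dotrBl dotrZl ee mulr1 subrr.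
set q := y - (p - (r / 2) *: e) in yz.
have -> : dotr y e = dotr p e - r / 2 + dotr q e.
  by rewrite /q !dotrBl dotrZl ee; ring.
have horizontal : (y - dotr y e *: e) - (p - dotr p e *: e) = q - dotr q e *: e.
  apply/rowP => i; rewrite /q !dotrBl dotrZl ee !mxE; ring.
have qe : dotr q e <= del.
  apply: le_trans (ler_norm _) _; apply: le_trans (cauchy_schwarz _ _) _.
  by rewrite e1 mulr1.
have : `|psi (y - dotr y e *: e) - psi (p - dotr p e *: e)| <= L * del.
  apply: le_trans (psiL _ _ (orth _) (orth _)) _.
  rewrite ler_wpM2l// horizontal; apply: le_trans (enorm_orthogonal_le _ e1) yz.
rewrite (_ : dotr y e = dotr p e - r / 2 + dotr q e); last first.
  by rewrite /q !dotrBl dotrZl ee; ring.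
rewrite ler_norml => /andP[H _].
move: H pe qe delE; lra.
Qed.

Lemma boundary_notin Om p : open Om -> boundary Om p -> ~ Om p.
Proof. by move=> oO [_ pO] Op; apply: pO; rewrite /interior; apply: open_nbhs_nbhs. Qed.

Lemma bounded_set_enorm Om : bounded_set Om ->
  exists2 M : R, 0 < M & forall x, Om x -> enorm x <= M.
Proof.
move=> [M [_ OM]]; exists (n%:R * (`|M| + 1) + 1).
  by rewrite ltr_wpDl// mulr_ge0// addr_ge0.
move=> x Ox; have xM : `|x| <= `|M| + 1.
  by apply: OM => //; rewrite (le_lt_trans (ler_norm M))// ltrDl.
rewrite (@le_trans _ _ (n%:R * (`|M| + 1)))//; last by rewrite lerDl.
apply: enorm_le_cube => i; apply: le_trans xM.
have /mapP[j Hj ->] : `|x ord0 i| \in [seq `|x k.1 k.2| | k : 'I_1 * 'I_n].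
  by apply/mapP; exists (ord0, i) => //=; rewrite mem_enum.
by rewrite [leRHS]/Num.norm /= mx_normrE; apply/bigmax_geP; right => /=; exists j.
Qed.

Lemma boundary_enorm Om M p : (forall x, Om x -> enorm x <= M) ->
  boundary Om p -> enorm p <= M + 1.
Proof.
move=> OM [cp _]; have [x [Ox /= xp]] := cp _ (nbhs_enorm p ltr01).
rewrite -(subKr x p); apply: le_trans (enormD _ _) _.
by rewrite enormN lerD ?OM// ltW.
Qed.

Lemma compact_boundary Om : bounded_set Om -> compact (boundary Om).
Proof.
move=> bO; apply: bounded_closed_compact; last first.
  apply: closedI; first exact: closed_closure.
  exact/open_closedC/open_interior.
have [M M0 OM] := bounded_set_enorm bO.
exists (M + 1); split; first exact: num_real.
move=> t Mt p /(boundary_enorm OM) pM.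
rewrite /= [leLHS]/Num.norm /= mx_normrE; apply/bigmax_leP; split=> [|[i j] _ /=].
  by rewrite (le_trans (enorm_ge0 p))// (le_trans pM)// ltW.
rewrite ord1 (le_trans (coord_le_enorm _ _))// (le_trans pM)//.
exact: ltW.
Qed.

(** Each boundary point has its own chart, hence its own constant; compactness of the boundary, in
    near-covering form, makes the constant uniform. *)
Lemma small_scale_corkscrew Om : bounded_set Om -> open Om ->
  lipschitz_boundary Om -> exists2 c : R, 0 < c &
  forall p r, boundary Om p -> 0 < r -> r < c -> corkscrew Om c p r.
Proof.
move=> bO oO lipO.
(* The covering argument asks for the property on full neighbourhoods, which also meet [Om]; the
   guard restricts it to the complement, where [epigraph_corkscrew] applies. *)
pose P c p := ~ Om p -> forall r, 0 < r -> r < c -> corkscrew Om c p r.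
suff [c c0 cP] : exists2 c : R, 0 < c & boundary Om `<=` P c.
  exists c => // p r Bp r0 rc; apply: cP => //; exact: boundary_notin.
have := compact_boundary bO => /compact_near_coveringP /(_ R 0^'+ P _) cover.
near (0 : R)^'+ => c; exists c => //.
near: c; apply: cover => x0 Bx0.
have [r0 [L0 [e [psi [r0_gt0 e1 psiL OmE]]]]] := lipO x0 Bx0.
have r20 : 0 < r0 / 2 by rewrite divr_gt0.
(* With p within r0/2 of x0 and r < r0/2, the ball of radius r about p stays in the chart. The
   absolute value is there because the Lipschitz constant comes without a sign. *)
exists ([set p | enorm (p - x0) < r0 / 2],
        [set c : R | 0 < c /\ c < Num.min (r0 / 2) (2 * (`|L0| + 1))^-1]).
  split; first exact: nbhs_enorm.
  near=> c; split=> //=.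
  near: c; apply: nbhs_right_lt.
  by rewrite lt_min r20 invr_gt0 mulr_gt0// ltr_wpDl.
move=> [p c] /= [px0 [c0]]; rewrite lt_min => /andP[cr0 cL] Op r r_gt0 rc.
apply: (@corkscrew_le _ _ (2 * (`|L0| + 1))^-1 _ _ r) => //.
  by rewrite ler_pM2r// ltW.
apply: (@epigraph_corkscrew _ x0 r0 _ e psi) => //.
- move=> y z ye ze; apply: le_trans (psiL y z ye ze) _.
  by rewrite ler_wpM2r ?enorm_ge0// ler_norm.
- by rewrite ltW// (lt_trans rc).
Unshelve. all: by end_near. Qed.

(** Three ranges of scales: below [c] the charts suffice; between [c] and [R1] a ball found at scale
    c/2 still has comparable size; beyond [R1] the bounded set [Om] is easily avoided. *)
Lemma exterior_corkscrew Om : (1 <= n)%N -> bounded_set Om -> open Om ->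
  lipschitz_boundary Om -> exists2 c : R, 0 < c &
  forall p r, boundary Om p -> 0 < r -> corkscrew Om c p r.
Proof.
move=> n_ge1 bO oO lipO.
have [c c0 cP] := small_scale_corkscrew bO oO lipO.
have [M M0 OM] := bounded_set_enorm bO.
(* For r >= R1 a ball of radius r/8 centred at distance r/2 from p misses [Om]: otherwise r/2 <= r/8
   + M + (M + 1). *)
pose R1 : R := 8 * (M + 1).
have R10 : 0 < R1 by rewrite mulr_gt0// addr_gt0.
(* One entry per range; the middle one ensures k r <= c (c/2) for r < R1. *)
pose k : R := Num.min c (Num.min (c ^+ 2 / (2 * R1)) 8^-1).
have k0 : 0 < k.
  rewrite !lt_min; apply/and3P; split=> //.
  by apply: divr_gt0; [exact: exprn_gt0|exact: mulr_gt0].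
exists k => //.
move=> p r Bp r0.
have [rc|cr] := ltP r c.
  apply: corkscrew_le (cP p r Bp r0 rc) => //.
  by rewrite ler_pM2r// ge_min lexx.
have c2c : c / 2 < c by rewrite ltr_pdivrMr// ltr_pMr// ltr1n.
have c20 : 0 < c / 2 by rewrite divr_gt0.
have [rR|Rr] := ltP r R1.
  apply: corkscrew_le (cP p (c / 2) Bp c20 c2c); last first.
    by rewrite (le_trans _ cr)// ltW.
  apply: (@le_trans _ _ (c ^+ 2 / (2 * R1) * R1)).
    apply: ler_pM; [exact: ltW|exact: ltW| |exact: ltW].
    by rewrite !ge_min lexx orbT.
  by rewrite le_eqVlt; apply/orP; left; apply/eqP; field; rewrite gt_eqF.
apply: (@corkscrew_le _ _ 8^-1 _ _ r) => //.
  by rewrite ler_pM2r// !ge_min lexx !orbT.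
pose e : 'rV[R]_n := delta_mx ord0 (Ordinal n_ge1).
have e1 : enorm e = 1.
  rewrite /enorm /dotr (bigD1 (Ordinal n_ge1))//= big1 => [|i /negbTE i0].
    by rewrite /e !mxE !eqxx/= mulr1 addr0 sqrtr1.
  by rewrite /e !mxE i0 andbF mulr0.
have pM := boundary_enorm OM Bp.
exists (p + (r / 2) *: e) => y yz.
have ze : enorm ((r / 2) *: e) = r / 2.
  by rewrite enormZ e1 mulr1 ger0_norm// divr_ge0// ltW.
split.
  apply: le_trans (enorm_triangle (p + (r / 2) *: e) _ _) _.
  rewrite addrAC subrr add0r ze; move: yz; lra.
move=> /OM yM.
have : enorm ((r / 2) *: e) <= enorm (y - (p + (r / 2) *: e)) + enorm y + enorm p.
  have -> : enorm ((r / 2) *: e) = enorm ((p + (r / 2) *: e - y) + (y - p)).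
    by congr enorm; apply/rowP => i; rewrite !mxE; ring.
  apply: le_trans (enormD _ _) _.
  rewrite (enormB _ y) -[leRHS]addrA; apply: lerD; first exact: lexx.
  by apply: le_trans (enormD _ _) _; rewrite enormN.
rewrite ze; move: yz pM yM Rr M0; rewrite /R1; lra.
Qed.

End exterior_corkscrew.

(** * Integrated comparison of gain and loss *)

Section energy_comparison.
Context {d} {T : measurableType d} {R : realType}.
Variable mu : {sigma_finite_measure set T -> \bar R}.
Local Open Scope ereal_scope.
Notation mu2 := (product_measure1 mu mu).

Lemma measurable_swap_fun (f : T * T -> R) : measurable_fun setT f ->
  measurable_fun setT (fun z : T * T => f (z.2, z.1)).
Proof.
move=> mf; apply: (measurableT_comp mf).
apply/measurable_fun_pair; [exact: measurable_snd|exact: measurable_fst].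
Qed.

Lemma integral_swap (f : T * T -> R) : measurable_fun setT f ->
  (forall z, 0 <= f z)%R ->
  \int[mu2]_z (f (z.2, z.1))%:E = \int[mu2]_z (f z)%:E.
Proof.
move=> mf f0.
rewrite (fubini_tonelli1 (fun z => (f (z.2, z.1))%:E)); first last.
- by move=> z; rewrite lee_fin.
- by apply/measurable_EFinP; exact: measurable_swap_fun.
rewrite (fubini_tonelli2 (fun z => (f z)%:E)) //.
exact/measurable_EFinP.
Qed.

(* The integral of [f] over [Q] is at least [(C2 - 2 C1)] times that of [w]. *)
Lemma comparison_eq0 (Q : set (T * T)) (f M P : T * T -> R) (w : T -> R)
    (C1 C2 : R) :
  measurable Q -> measurable_fun setT f -> measurable_fun setT M ->
  measurable_fun setT P -> measurable_fun setT w ->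
  (forall z, 0 <= M z)%R -> (forall z, 0 <= P z)%R -> (forall x, 0 <= w x)%R ->
  (0 <= C1)%R -> (2 * C1 < C2)%R ->
  (forall z, Q z -> - f z <= M z + M (z.2, z.1))%R ->
  (forall z, Q z -> P z <= Num.max (f z) 0)%R ->
  (forall z, ~ Q z -> P z = 0)%R ->
  (forall x, \int[mu]_y (M (x, y))%:E <= (C1 * w x)%:E) ->
  {ae mu, forall x, (C2 * w x)%:E <= \int[mu]_y (P (x, y))%:E} ->
  \int[mu]_x (w x)%:E < +oo ->
  \int[mu2]_(z in Q) (f z)%:E <= 0 ->
  \int[mu]_x (w x)%:E = 0.
Proof.
move=> mQ mf mM mP mw M0 P0 w0 C10 C12 fM fP PQ IM IP wfin IQ.
have mE g : measurable_fun setT g -> measurable_fun setT (EFin \o g : T * T -> \bar R).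
  by move=> mg; exact/measurable_EFinP.
have mwE : measurable_fun setT (EFin \o w) by exact/measurable_EFinP.
have wE0 x : setT x -> 0 <= (w x)%:E by rewrite lee_fin.
have C20 : (0 <= C2)%R by rewrite (le_trans _ (ltW C12))// mulr_ge0.
have mM' := measurable_swap_fun mM.
set W := \int[mu]_x (w x)%:E in wfin *.
have W0 : 0 <= W by exact: integral_ge0.
have IC C : (0 <= C)%R -> \int[mu]_x (C * w x)%:E = C%:E * W.
  by move=> C0; rewrite -ge0_integralZl_EFin.
have intM : \int[mu2]_z (M z)%:E <= C1%:E * W.
  rewrite (fubini_tonelli1 (fun z => (M z)%:E)) //; last exact: mE.
  rewrite -IC //; apply: ge0_le_integral => //.
  - by move=> x _; apply: integral_ge0 => y _; rewrite lee_fin.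
  - by apply: (measurable_fun_fubini_tonelli_F (fun z => (M z)%:E)) => //; exact: mE.
  - by apply/measurable_EFinP; exact: measurable_funM.
  - by move=> x _; exact: IM.
have intP : C2%:E * W <= \int[mu2]_z (P z)%:E.
  rewrite (fubini_tonelli1 (fun z => (P z)%:E)) //; last exact: mE.
  rewrite -IC //; apply: ae_ge0_le_integral => //.
  - by move=> x _; rewrite lee_fin mulr_ge0.
  - by apply/measurable_EFinP; exact: measurable_funM.
  - by move=> x _; apply: integral_ge0 => y _; rewrite lee_fin.
  - by apply: (measurable_fun_fubini_tonelli_F (fun z => (P z)%:E)) => //; exact: mE.
  - by apply: filterS IP => x + _.
have mfQ : measurable_fun Q (EFin \o f).
  by apply: measurable_funTS; exact: mE.
(* Either point of a pair may be the truncated one, so the loss is dominated by [M] plus its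
   transpose; both have the same integral, whence the factor 2. *)
have neg : \int[mu2]_(z in Q) ((EFin \o f)^\- z) <= 2%:E * (C1%:E * W).
  apply: (@le_trans _ _ (\int[mu2]_z ((M z)%:E + (M (z.2, z.1))%:E))).
    rewrite integral_mkcond; apply: ge0_le_integral => //.
    - by move=> z _; exact: erestrict_ge0.
    - apply/(measurable_restrictT _ _).1 => //; exact: measurable_funeneg.
    - by apply: emeasurable_funD; exact: mE.
    move=> z _; rewrite patchE; case: ifPn => [|_]; last first.
      by rewrite -EFinD lee_fin addr_ge0.
    rewrite inE => Qz; rewrite funenegE -EFinD /= -EFin_max lee_fin.
    by rewrite ge_max fM//= addr_ge0.
  rewrite ge0_integralD //; first last.
  - exact: mE.
  - by move=> z _; rewrite lee_fin.
  - exact: mE.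
  - by move=> z _; rewrite lee_fin.
  rewrite integral_swap //.
  rewrite -mule2n -mule_natl; apply: lee_wpmul2l; first by rewrite lee_fin.
  exact: intM.
have pos : C2%:E * W <= \int[mu2]_(z in Q) ((EFin \o f)^\+ z).
  apply: le_trans intP _; rewrite [leRHS]integral_mkcond; apply: ge0_le_integral => //.
  - by move=> z _; rewrite lee_fin.
  - exact: mE.
  - apply/(measurable_restrictT _ _).1 => //; exact: measurable_funepos.
  move=> z _; rewrite patchE; case: ifPn => [|]; last first.
    by rewrite notin_setE => /PQ ->.
  by rewrite inE => Qz; rewrite funeposE /= -EFin_max lee_fin fP.
have Wfin : W \is a fin_num by rewrite ge0_fin_numE.
have negfin : \int[mu2]_(z in Q) ((EFin \o f)^\- z) \is a fin_num.
  rewrite ge0_fin_numE; last exact: integral_ge0.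
  by apply: le_lt_trans neg _; rewrite -(fineK Wfin) -!EFinM ltry.
(* A nonpositive integral means that the positive part integrates to at most the negative one. As
   [W] is finite and [C2 > 2 * C1], only [W = 0] remains. *)
have : C2%:E * W <= 2%:E * (C1%:E * W).
  apply: le_trans pos (le_trans _ neg).
  by move: IQ; rewrite integralE sube_le0.
rewrite -(fineK Wfin) -!EFinM lee_fin mulrA -subr_ge0 -mulrBl => H.
congr EFin; apply/eqP; rewrite eq_le fine_ge0 // andbT.
by rewrite -(nmulr_rge0 _ (_ : 2 * C1 - C2 < 0)%R) // subr_lt0.
Qed.

End energy_comparison.

(** * Iterated integrals over a set and domination *)

Section iterated_integrals.
Context {d} {T : measurableType d} {R : realType}.
Variable mu : {sigma_finite_measure set T -> \bar R}.
Variable A : set T.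
Hypothesis mA : measurable A.

Lemma measurable_partial_integral (h : T * T -> R) :
  measurable_fun setT h -> (forall z, 0 <= h z) ->
  measurable_fun setT (fun x => \int[mu]_(y in A) (h (x, y))%:E)%E.
Proof.
move=> mh h0; pose h' (z : T * T) := (h z * \1_A z.2)%:E.
rewrite (_ : (fun _ => _) = fubini_F mu h').
  apply: measurable_fun_fubini_tonelli_F => [|z]; last first.
    by rewrite lee_fin mulr_ge0// indicE.
  apply/measurable_EFinP; apply: measurable_funM => //.
  apply: (measurableT_comp _ measurable_snd).
  exact: measurable_indic.
apply/funext => x; rewrite /fubini_F [LHS]integral_mkcond.
apply: eq_integral => y _.
by rewrite patchE /h' indicE /=; case: ifPn; rewrite ?mulr1 ?mulr0.
Qed.

(** Compares the fractional seminorm of the truncation with that of [u]. *)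
Lemma le_iterated_integral (h1 h2 : T * T -> R) :
  measurable_fun setT h1 -> measurable_fun setT h2 ->
  (forall z, 0 <= h1 z) -> (forall z, 0 <= h2 z) ->
  (forall x y, A x -> A y -> h1 (x, y) <= h2 (x, y)) ->
  (\int[mu]_(x in A) \int[mu]_(y in A) (h1 (x, y))%:E <=
   \int[mu]_(x in A) \int[mu]_(y in A) (h2 (x, y))%:E)%E.
Proof.
move=> mh1 mh2 h10 h20 h12; apply: ge0_le_integral => //.
- by move=> x _; apply: integral_ge0 => y _; rewrite lee_fin.
- by apply: measurable_funTS; exact: measurable_partial_integral.
- by apply: measurable_funTS; exact: measurable_partial_integral.
move=> x Ax; apply: ge0_le_integral => //.
- by move=> y _; rewrite lee_fin.
- apply: measurable_funTS; apply/measurable_EFinP.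
  exact: (measurableT_comp mh1 (measurable_pair1 x)).
- apply: measurable_funTS; apply/measurable_EFinP.
  exact: (measurableT_comp mh2 (measurable_pair1 x)).
by move=> y Ay; rewrite lee_fin h12.
Qed.

Lemma integrable_le_addr (f h : T -> R) (k : R) : (mu A < +oo)%E ->
  measurable_fun A h -> mu.-integrable A (EFin \o f) ->
  (forall x, A x -> `|h x| <= `|f x| + `|k|) -> mu.-integrable A (EFin \o h).
Proof.
move=> Afin mh intf hf.
have ik : mu.-integrable A (EFin \o cst `|k|).
  apply/integrableP; split; first exact/measurable_EFinP/measurable_cst.
  rewrite (eq_integral (fun=> `|k|%:E)); last by move=> x _ /=; rewrite normr_id.
  by rewrite integral_cst//; apply: lte_mul_pinfty.
have iuk : mu.-integrable A (EFin \o (fun x => `|f x| + `|k|)).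
  have := integrableD mA (integrable_abse intf) ik.
  by apply: eq_integrable => // x _.
apply: le_integrable iuk => //; first exact/measurable_EFinP.
move=> x Ax /=; rewrite lee_fin.
by rewrite (ger0_norm (addr_ge0 (normr_ge0 _) (normr_ge0 _))) hf.
Qed.

End iterated_integrals.

(** * Almost-everywhere statements and integrals against indicators *)

Section indicator_integrals.
Context {d} {T : measurableType d} {R : realType}.
Variable mu : {measure set T -> \bar R}.

Lemma sub_ae (P Q : T -> Prop) : (forall x, P x -> Q x) ->
  {ae mu, forall x, P x} -> {ae mu, forall x, Q x}.
Proof. by move=> PQ; apply: filterS. Qed.

Lemma sub_ae2 (P P' Q : T -> Prop) : (forall x, P x -> P' x -> Q x) ->
  {ae mu, forall x, P x} -> {ae mu, forall x, P' x} -> {ae mu, forall x, Q x}.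
Proof. by move=> PQ; apply: filterS2. Qed.

Lemma ae_eq0_integral0 (w : T -> R) : measurable_fun setT w ->
  (forall x, 0 <= w x) -> (\int[mu]_x (w x)%:E = 0)%E ->
  {ae mu, forall x, w x = 0}.
Proof.
move=> mw w0 Iw; have mwE : measurable_fun setT (EFin \o w) by exact/measurable_EFinP.
have [+ _] := ae_eq_integral_abs mu measurableT mwE.
rewrite (eq_integral (EFin \o w)); last by move=> x _ /=; rewrite ger0_norm.
by move=> /(_ Iw); apply: filterS => x /(_ I) [].
Qed.

(** For the loss at one point: [D] will be the set of high outer values, [E] the complement of a
    ball, [h] the kernel. The inclusion holds only almost everywhere because the outer bound is an
    essential supremum. *)
Lemma integral_indic_mul_le (a C : R) (D E : set T) (h : T -> R) :
  measurable D -> measurable E -> measurable_fun setT h -> 0 <= a ->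
  (forall y, 0 <= h y) -> {ae mu, forall y, D y -> E y} ->
  (\int[mu]_(y in E) (h y)%:E <= C%:E)%E ->
  (\int[mu]_y (a * \1_D y * h y)%:E <= (a * C)%:E)%E.
Proof.
move=> mD mE mh a0 h0 DE IC.
have mDh : measurable_fun setT (fun y => \1_D y * h y).
  by apply: measurable_funM => //; exact: measurable_indic.
have Dh0 y : 0 <= \1_D y * h y by rewrite mulr_ge0// indicE.
rewrite (eq_integral (fun y => (a%:E * (\1_D y * h y)%:E)%E)); last first.
  by move=> y _; rewrite -EFinM mulrA.
rewrite ge0_integralZl_EFin//; last first.
- exact/measurable_EFinP.
- by move=> y _; rewrite lee_fin.
rewrite EFinM; apply: lee_wpmul2l; first by rewrite lee_fin.
apply: le_trans IC; rewrite [leRHS]integral_mkcond.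
apply: ae_ge0_le_integral => //.
- by move=> y _; rewrite lee_fin.
- exact/measurable_EFinP.
- by move=> y _; apply: erestrict_ge0 => z _; rewrite lee_fin.
- apply/(measurable_restrictT _ _).1 => //; apply/measurable_EFinP.
  exact: measurable_funTS.
apply: filterS DE => y DE _; rewrite patchE indicE.
case: ifPn => [|]; last first.
  by rewrite notin_setE => Ey; rewrite memNset ?mul0r// => /DE.
by move=> _; case: (y \in D); rewrite ?mul1r ?mul0r lee_fin.
Qed.

(** For the gain at one point: [B] will be the set of low values, [E] a ball of radius [rho]. *)
Lemma integral_indic_mul_ge (a b : R) (B E : set T) :
  measurable B -> measurable E -> 0 <= a -> (b%:E <= mu (B `&` E))%E ->
  ((a * b)%:E <= \int[mu]_y (a * \1_B y * \1_E y)%:E)%E.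
Proof.
move=> mB mE a0 bBE; have mBE : measurable (B `&` E) by exact: measurableI.
rewrite (eq_integral (fun y => (a%:E * (\1_(B `&` E) y)%:E)%E)); last first.
  by move=> y _; rewrite -EFinM indicI mulrA.
rewrite ge0_integralZl_EFin//; last first.
  by apply/measurable_EFinP; exact: measurable_indic.
by rewrite integral_indic// setIT EFinM lee_wpmul2l// lee_fin.
Qed.

End indicator_integrals.

(** * Pointwise effect of truncation on the energy *)

Section truncation.
Context {R : realType} {n : nat}.
Variables (Phi : R -> R) (L gam s : R).
Hypothesis L_gt0 : 0 < L.
Hypothesis gam_gt0 : 0 < gam.
Hypothesis s_gt0 : 0 < s.
Hypothesis Phi_norm : forall t, Phi t = Phi `|t|.
Hypothesis Phi_lip : forall a b, 0 <= a -> a <= b ->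
  0 <= Phi b - Phi a <= L * (b - a).
Hypothesis Phi_lin : forall a b, 1 <= a -> a <= b ->
  gam * (b - a) <= Phi b - Phi a.

Lemma growth_le t t' : `|t'| <= `|t| -> Phi t' <= Phi t.
Proof.
move=> tt; rewrite Phi_norm (Phi_norm t) -subr_ge0.
by have /andP[] := Phi_lip (normr_ge0 t') tt.
Qed.

Lemma growth_dist t t' : Phi t' - Phi t <= L * `|t' - t|.
Proof.
have [tt|/ltW tt] := leP `|t'| `|t|.
  by rewrite (@le_trans _ _ 0)// ?subr_le0 ?growth_le// mulr_ge0// ltW.
rewrite (Phi_norm t') (Phi_norm t).
have /andP[_ H] := Phi_lip (normr_ge0 t) tt.
apply: le_trans H _; rewrite ler_pM2l//.
exact: lerB_dist.
Qed.

Lemma growth_continuous : continuous Phi.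
Proof.
move=> x; apply/cvgrPdist_lt => e e0.
near=> y; apply: (@le_lt_trans _ _ (L * `|x - y|)).
  rewrite ler_norml growth_dist andbT lerNl opprB distrC; exact: growth_dist.
rewrite mulrC -ltr_pdivlMr//; near: y.
by apply: (@cvgr_dist_lt _ _ _ (nbhs x) _ id x) => //; rewrite divr_gt0.
Unshelve. all: by end_near. Qed.

Lemma measurable_growth : measurable_fun setT Phi.
Proof. exact: continuous_measurable_fun growth_continuous. Qed.

Implicit Types (x y : 'rV[R]_n).
Variables (Om : set 'rV[R]_n) (u : 'rV[R]_n -> R) (k : R).

(** The competitor is written [u - overshoot], since the bounds on gain and loss are both multiples
    of the overshoot. *)
Definition overshoot x : R := if x \in Om then Num.max (u x - k) 0 else 0.

Lemma overshoot_ge0 x : 0 <= overshoot x.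
Proof. by rewrite /overshoot; case: ifP => // _; rewrite le_max lexx orbT. Qed.

Lemma overshoot_minr x : Om x -> u x - overshoot x = Num.min (u x) k.
Proof.
move=> Ox; rewrite /overshoot mem_set// maxEle minEle subr_le0.
by case: ifPn; rewrite ?subr0// opprB addrCA subrr addr0.
Qed.

Lemma overshoot_out x : ~ Om x -> overshoot x = 0.
Proof. by move=> Ox; rewrite /overshoot memNset. Qed.

Lemma overshoot_below x : u x <= k -> overshoot x = 0.
Proof.
by move=> uk; rewrite /overshoot; case: ifP => // _; apply/max_idPr; rewrite subr_le0.
Qed.

Lemma overshoot_gt0 x : overshoot x != 0 -> Om x /\ k < u x.
Proof.
move=> o0; have [Ox|/overshoot_out o] := pselect (Om x); last by rewrite o eqxx in o0.
split=> //; rewrite ltNge; apply/negP => /overshoot_below o.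
by rewrite o eqxx in o0.
Qed.

(** The integrand of the minimality inequality for the truncated competitor, positive where
    truncation lowers the energy. *)
Definition energy_gain (z : Rn R n * Rn R n) : R :=
  let v x := u x - overshoot x in let r := enorm ((z.1 : 'rV[R]_n) - z.2) in
  (Phi ((u z.1 - u z.2) / r) - Phi ((v z.1 - v z.2) / r)) / r `^ (n%:R - 1 + s).

Lemma energy_gainC x y : energy_gain (x, y) = energy_gain (y, x).
Proof.
rewrite /energy_gain /= (enormB y) [Phi ((u y - u x) / _)]Phi_norm.
rewrite [Phi ((u y - _ - _) / _)]Phi_norm -(normrN ((u y - u x) / _)).
rewrite -(normrN ((u y - _ - _) / _)) -!Phi_norm -!mulNr !opprB.
by congr ((Phi (_ / _) - Phi (_ / _)) / _); ring.
Qed.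

Lemma energy_gain0 x y : enorm (x - y) = 0 -> energy_gain (x, y) = 0.
Proof. by rewrite /energy_gain /= => ->; rewrite invr0 !mulr0 subrr mul0r. Qed.

(** The difference quotient inside [Phi] supplies the missing power of |x - y| that turns the weight
    n - 1 + s into n + s. *)
Lemma rkernelE x y a : 0 < enorm (x - y) ->
  a * rkernel (n%:R + s) x y = a / enorm (x - y) / enorm (x - y) `^ (n%:R - 1 + s).
Proof.
move=> r0; rewrite /rkernel -mulrA -invfM; congr (_ / _).
have -> : n%:R + s = 1 + (n%:R - 1 + s) by rewrite addrA addrCA subrr addr0.
rewrite powRD ?(gt_eqF r0) ?implybT// powRr1 ?(ltW r0)//.
Qed.

Definition high_outside : set (Rn R n) := [set y | ~ Om y /\ k < u y].

Lemma minr_dist (a b c : R) : `|Num.min a c - Num.min b c| <= `|a - b|.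
Proof.
have H1 := ler_norm (a - b); have H2 := ler_norm (b - a); rewrite distrC in H2.
rewrite ler_norml !minEle; move: H1 H2; set m := `|a - b|.
by case: ifPn; case: ifPn; rewrite -?ltNge => *; lra.
Qed.

(** If y is high and outside, only the value at x changes, by the overshoot, and [Phi] is
    [L]-Lipschitz. Otherwise both values become their minimum with [k], a contraction, and the
    energy of the pair does not rise. *)
Lemma energy_gain_ge x y : Om x ->
  - energy_gain (x, y) <=
    L * overshoot x * \1_high_outside (y : Rn R n) * rkernel (n%:R + s) x y.
Proof.
move=> Ox; have rhs0 : 0 <= L * overshoot x *
    \1_high_outside (y : Rn R n) * rkernel (n%:R + s) x y.
  by rewrite !mulr_ge0 ?overshoot_ge0 ?rkernel_ge0 ?(ltW L_gt0)// indicE.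
have [r0|r_neq0] := eqVneq (enorm (x - y)) 0.
  by rewrite energy_gain0// oppr0.
have r0 : 0 < enorm (x - y) by rewrite lt_def r_neq0 enorm_ge0.
have rq0 : 0 <= (enorm (x - y) `^ (n%:R - 1 + s))^-1 by rewrite invr_ge0 powR_ge0.
have [Dy|Dy] := pselect (high_outside y).
  rewrite indicE mem_set// mulr1 rkernelE// /energy_gain /= -mulNr opprB.
  rewrite ler_wpM2r//; apply: le_trans (growth_dist _ _) _.
  rewrite -mulrA ler_pM2l// -mulrBl normrM (gtr0_norm (_ : 0 < (enorm (x - y))^-1)); last first.
    by rewrite invr_gt0.
  rewrite ler_pM2r ?invr_gt0//.
  have [Oy _] := Dy; rewrite (overshoot_out Oy) subr0.
  rewrite (_ : _ - _ = - overshoot x); last by ring.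
  by rewrite normrN ger0_norm// overshoot_ge0.
apply: le_trans rhs0; rewrite oppr_le0 /energy_gain /= mulr_ge0// subr_ge0.
apply: growth_le; rewrite !normrM ler_wpM2r//.
(* In [Om] this is the truncation; outside, y is not high, so the minimum changes nothing. *)
have -> : u y - overshoot y = Num.min (u y) k.
  have [Oy|Oy] := pselect (Om y); first exact: overshoot_minr.
  rewrite overshoot_out// subr0; apply/esym/min_idPl.
  by rewrite leNgt; apply/negP => ky; apply: Dy.
by rewrite overshoot_minr// minr_dist.
Qed.

(** The truncated quotient (k - u y) / |x - y| is at least d / rho >= 1, so [Phi] grows at rate at
    least [gam] between it and the original quotient, and the two differ by the overshoot over |x -
    y|. *)
Lemma energy_gain_le d rho x y : 0 < d -> 0 < rho -> rho <= d ->
  enorm (x - y) <= rho -> u y <= k - d ->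
  gam * (rho `^ (n%:R + s))^-1 * overshoot x <= Num.max (energy_gain (x, y)) 0.
Proof.
move=> d0 rho0 rhod xy uy.
have [->|wx] := eqVneq (overshoot x) 0; first by rewrite mulr0 le_max lexx orbT.
have [Ox kx] := overshoot_gt0 wx.
have uyk : u y <= k by rewrite (le_trans uy)// gerBl ltW.
have r0 : 0 < enorm (x - y).
  rewrite lt_def enorm_ge0 andbT enorm_eq0 subr_eq0; apply/eqP => xE.
  by move: kx; rewrite xE ltNge uyk.
rewrite le_max; apply/orP; left.
have wx0 : 0 < overshoot x by rewrite lt_def wx overshoot_ge0.
apply: (@le_trans _ _ (gam * overshoot x * rkernel (n%:R + s) x y)).
  rewrite mulrAC ler_pM2l ?mulr_gt0// lef_pV2 ?posrE ?powR_gt0//.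
  by rewrite ge0_ler_powR// ?nnegrE ?(ltW rho0) ?enorm_ge0// addr_ge0// ltW.
rewrite rkernelE// /energy_gain /= ler_wpM2r ?invr_ge0 ?powR_ge0//.
rewrite (overshoot_below uyk) subr0 overshoot_minr// (min_idPr (ltW kx)).
have wE : overshoot x = u x - k.
  by rewrite /overshoot mem_set//; apply/max_idPl; rewrite subr_ge0 ltW.
have -> : gam * overshoot x / enorm (x - y) =
    gam * ((u x - u y) / enorm (x - y) - (k - u y) / enorm (x - y)).
  by rewrite wE; ring.
have uyk0 : 0 <= k - u y by rewrite subr_ge0.
apply: Phi_lin.
  rewrite ler_pdivlMr// mul1r (le_trans xy)// (le_trans rhod)//.
  by rewrite lerBrDl -lerBrDr.
by rewrite ler_pM2r ?invr_gt0// lerB// ltW.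
Qed.

End truncation.

(** * Admissibility of the truncated competitor *)

Section competitor.
Context {R : realType} {n : nat}.
Variables (Om : set 'rV[R]_n) (u : 'rV[R]_n -> R) (k : R).
Hypothesis Om_open : open Om.
Hypothesis mu : measurable_fun [set: Rn R n] u.

Lemma measurable_overshoot : measurable_fun [set: Rn R n] (overshoot Om u k).
Proof.
have mOm : measurable (Om : set (Rn R n)) by exact: open_measurable_Rn.
rewrite (_ : overshoot Om u k = (fun x => Num.max (u x - k) 0) \_ Om).
  apply/(measurable_restrictT _ mOm).1.
  apply: measurable_funTS; apply: measurable_maxr; last exact: measurable_cst.
  by apply: measurable_funB; last exact: measurable_cst.
by apply/funext => x; rewrite patchE.
Qed.

Lemma bounded_finite_measure : bounded_set Om -> (lebesgue n (Om : set (Rn R n)) < +oo)%E.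
Proof.
move=> /bounded_set_enorm[M M0 OM].
apply: (@le_lt_trans _ _ (lebesgue n (cube (0 : 'rV[R]_n) M))).
  apply: le_measure; rewrite ?inE.
  - exact: open_measurable_Rn.
  - exact: measurable_cube.
  by move=> x /OM xM; apply: enorm_cube; rewrite sub0r enormN.
rewrite [ltLHS](_ : _ = ((2 * M) ^+ n)%:E) ?ltry//.
by apply: lebesgue_cube; exact: ltW.
Qed.

(** The minimum with [k] is 1-Lipschitz, which controls the seminorm, and is bounded by |u| + |k|,
    integrable because [Om] has finite measure. *)
Lemma competitor_in_Ws s : bounded_set Om -> in_Ws s Om u ->
  in_Ws s Om (fun x => u x - overshoot Om u k x).
Proof.
move=> bO [_ iu Wu]; have mOm : measurable (Om : set (Rn R n)) by exact: open_measurable_Rn.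
have mo := measurable_overshoot.
have mv : measurable_fun [set: Rn R n] (fun x => u x - overshoot Om u k x).
  exact: measurable_funB.
have mh (w : Rn R n -> R) : measurable_fun setT w ->
    measurable_fun setT (fun z : Rn R n * Rn R n =>
      `|w z.1 - w z.2| / enorm ((z.1 : 'rV[R]_n) - z.2) `^ (n%:R + s)).
  move=> mw; apply: measurable_funM; last exact: measurable_rkernel.
  apply: (measurableT_comp (@normr_measurable _ _)).
  apply: measurable_funB; apply: (measurableT_comp mw).
    exact: measurable_fst.
  exact: measurable_snd.
have h0 (w : Rn R n -> R) z : 0 <=
      `|w z.1 - w z.2| / enorm ((z.1 : 'rV[R]_n) - z.2) `^ (n%:R + s).
  by apply: mulr_ge0; rewrite ?invr_ge0 ?powR_ge0.
split; [exact: mv| |].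
  apply: (integrable_le_addr mOm (bounded_finite_measure bO) _ iu (k := k)).
    exact: measurable_funTS.
  move=> x Ox; rewrite overshoot_minr // minEle.
  by case: ifPn => _; rewrite ?lerDl ?lerDr.
apply: le_lt_trans Wu.
apply: (le_iterated_integral (lebesgue n) mOm (mh _ mv) (mh _ mu) (h0 _) (h0 _)).
move=> x y Ox Oy; rewrite /= ler_wpM2r ?invr_ge0 ?powR_ge0 //.
rewrite !overshoot_minr //; exact: minr_dist.
Qed.

End competitor.

(** * Essential suprema and Chebyshev's inequality *)

Section essential_bounds.
Context {d} {T : measurableType d} {R : realType}.
Variable mu : {measure set T -> \bar R}.
Implicit Types A B : set T.

Lemma le_measure_ae A B : measurable A -> measurable B ->
  {ae mu, forall x, A x -> B x} -> (mu A <= mu B)%E.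
Proof.
move=> mA mB [N [mN N0 AB]]; rewrite -(measureU0 mB mN N0).
apply: le_measure; rewrite ?inE//; first exact: measurableU.
move=> x Ax; have [Bx|nBx] := pselect (B x); [by left|right].
by apply: AB => /= /(_ Ax).
Qed.

(** Positivity of the total measure selects the essential supremum in the definition of [Lnorm];
    [0 <= K] absorbs the value 0 taken off [A]. *)
Lemma Lnorm_oo_leP A (u : T -> R) (K : R) : (0 < mu setT)%E -> 0 <= K ->
  (Lnorm mu +oo%E ((EFin \o u) \_ A) <= K%:E)%E <->
  {ae mu, forall x, A x -> `|u x| <= K}.
Proof.
move=> mu0 K0; rewrite unlock mu0; split=> [/ess_supP|H].
  by apply: sub_ae => x + Ax; rewrite /= patchE mem_set//= lee_fin.
apply/ess_supP; apply: sub_ae H => x H; rewrite /= patchE.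
case: ifPn => [/set_mem/H uK|_] /=; first by rewrite lee_fin.
by rewrite normr0 lee_fin.
Qed.

Lemma chebyshev_ge A (u : T -> R) (c : R) : measurable A ->
  mu.-integrable A (EFin \o u) -> 0 < c ->
  exists2 m : R, 0 < m &
    forall t, m <= t -> (mu (A `&` [set x | (t < u x)%R]) <= c%:E)%E.
Proof.
move=> mA iu c0; have /integrableP[mu_ fu] := iu.
have mur : measurable_fun A u by exact/measurable_EFinP.
set I := (\int[mu]_(x in A) _)%E in fu.
have I0 : (0 <= I)%E by exact: integral_ge0.
(* The measure is at most I / t, hence at most [c] once t >= I / c; the 1 only keeps the threshold
   positive. *)
exists (fine I / c + 1); first by rewrite ltr_wpDl// divr_ge0 ?fine_ge0// ltW.
move=> t mt; have t0 : 0 < t.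
  by apply: lt_le_trans mt; rewrite ltr_wpDl// divr_ge0 ?fine_ge0// ltW.
have mS : measurable (A `&` [set x | (t < u x)%R]).
  rewrite (_ : [set x | _] = u @^-1` `]t, +oo[%classic); first exact: mur.
  by apply/seteqP; split=> x; rewrite /= in_itv/= andbT.
have := le_integral_abse mu mA mu_ t0; rewrite -/I => H.
have : (t%:E * mu (A `&` [set x | (t < u x)%R]) <= (t * c)%:E)%E.
  apply: (@le_trans _ _ I).
    apply: le_trans H; apply: lee_wpmul2l; first by rewrite lee_fin ltW.
    apply: le_measure; rewrite ?inE//.
      apply: emeasurable_fun_c_infty => //; exact: measurableT_comp.
    by move=> x [Ax /= tx]; split=> //=; rewrite lee_fin (le_trans (ltW tx))// ler_norm.
  rewrite -(fineK (_ : I \is a fin_num)) ?ge0_fin_numE// lee_fin.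
  rewrite -ler_pdivrMr//; apply: le_trans mt; by rewrite lerDl.
by rewrite EFinM lee_pmul2l.
Qed.

End essential_bounds.

(** Chooses the ratio t = rho / d: t^-s blows up as t tends to 0. *)
Lemma small_power {R : realType} (s c1 c2 t0 : R) : 0 < s -> 0 < c1 -> 0 < t0 ->
  exists t, [/\ 0 < t, t <= t0 & c2 < c1 * (t `^ s)^-1].
Proof.
move=> s0 c10 t00; set q := c1 / (`|c2| + 1).
have q0 : 0 < q by rewrite divr_gt0// ltr_wpDl.
exists (Num.min t0 (q `^ s^-1)).
have t_gt0 : 0 < Num.min t0 (q `^ s^-1) by rewrite lt_min t00 powR_gt0.
split=> //; first by rewrite ge_min lexx.
apply: (@lt_le_trans _ _ (`|c2| + 1)); first by rewrite (le_lt_trans (ler_norm _))// ltrDl.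
rewrite ler_pdivlMr ?powR_gt0//.
rewrite mulrC -ler_pdivlMr ?ltr_wpDl// -/q.
have {2}-> : q = (q `^ s^-1) `^ s by rewrite -powRrM mulVf ?gt_eqF// powRr1// ltW.
apply: ge0_ler_powR; rewrite ?nnegrE ?powR_ge0 ?(ltW s0) ?(ltW t_gt0)//.
by rewrite ge_min lexx orbT.
Qed.

(** * Invariance under a change of sign *)

Section sign_change.
Context {R : realType} {n : nat}.
Variables (g : R -> R) (s : R) (Om : set 'rV[R]_n).
Hypothesis calG_norm : forall t, calG g t = calG g `|t|.

Lemma in_WsN (u : 'rV[R]_n -> R) : in_Ws s Om u -> in_Ws s Om (fun x => - u x).
Proof.
move=> [mu iu Wu]; split.
- exact: measurableT_comp mu.
- exact: integrableN iu.
apply: le_lt_trans Wu; rewrite le_eqVlt; apply/orP; left; apply/eqP.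
apply: eq_integral => x _; apply: eq_integral => y _.
by rewrite -opprD normrN.
Qed.

(** A competitor v of -u corresponds to the competitor -v of u, with the same integrand since
    [calG g] is even. *)
Lemma minimizerN (u : 'rV[R]_n -> R) :
  minimizer s g Om u -> minimizer s g Om (fun x => - u x).
Proof.
move=> [uW umin]; split; first exact: in_WsN.
move=> v vW vu; have := umin _ (in_WsN vW).
have GN a b r : calG g ((- a - - b) / r) = calG g ((a - b) / r).
  by rewrite calG_norm -opprD mulNr normrN -calG_norm.
move=> H; apply: le_trans (H _).
  rewrite le_eqVlt; apply/orP; left; apply/eqP; apply: eq_integral => z _.
  by rewrite !GN.
by apply: sub_ae vu => x vu Ox; rewrite vu// opprK.
Qed.

End sign_change.

(** * One-sided bounds for minimizers *)

Section minimizer_bound.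
Context {R : realType} {n : nat}.
Variables (g : R -> R) (s L gam C : R) (Om : set 'rV[R]_n).
Hypothesis L_gt0 : 0 < L.
Hypothesis gam_gt0 : 0 < gam.
Hypothesis s_gt0 : 0 < s.
Hypothesis C_gt0 : 0 < C.
Hypothesis calG_norm : forall t, calG g t = calG g `|t|.
Hypothesis calG_lip : forall a b, 0 <= a -> a <= b ->
  0 <= calG g b - calG g a <= L * (b - a).
Hypothesis calG_lin : forall a b, 1 <= a -> a <= b ->
  gam * (b - a) <= calG g b - calG g a.
Hypothesis tail_le : forall (x : 'rV[R]_n) (d : R), 0 < d ->
  (\int[lebesgue n]_(y in [set y | (d <= enorm (x - (y : 'rV[R]_n)))%R])
    (rkernel (n%:R + s) x y)%:E <= (C * (d `^ s)^-1)%:E)%E.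
Hypothesis Om_open : open Om.
Hypothesis Om_bounded : bounded_set Om.

Lemma measurable_energy_gain (u : Rn R n -> R) (k : R) :
  measurable_fun setT u -> measurable_fun setT (energy_gain (calG g) s Om u k).
Proof.
move=> mu; have mv : measurable_fun [set: Rn R n] (fun x => u x - overshoot Om u k x).
  apply: measurable_funB; [exact: mu|exact: measurable_overshoot].
have mG := measurable_growth L_gt0 calG_norm calG_lip.
have mrV : measurable_fun setT (fun z : Rn R n * Rn R n =>
    (enorm ((z.1 : 'rV[R]_n) - z.2))^-1).
  rewrite (_ : (fun _ => _) = fun z : Rn R n * Rn R n => rkernel 1 z.1 z.2).
    exact: measurable_rkernel.
  by apply/funext => z; rewrite /rkernel powRr1 ?enorm_ge0.
have mq (w : Rn R n -> R) : measurable_fun setT w -> measurable_fun setT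
    (fun z : Rn R n * Rn R n =>
      calG g ((w z.1 - w z.2) / enorm ((z.1 : 'rV[R]_n) - z.2))).
  move=> mw; apply: (measurableT_comp mG). apply: measurable_funM; last exact: mrV.
  apply: measurable_funB; apply: (measurableT_comp mw).
    exact: measurable_fst.
  exact: measurable_snd.
apply: measurable_funM; last exact: measurable_rkernel.
apply: measurable_funB; first exact: mq.
exact: (mq _ mv).
Qed.

Lemma measurable_le_const (u : Rn R n -> R) (k : R) :
  measurable_fun setT u -> measurable [set y : Rn R n | u y <= k].
Proof.
move=> mu; rewrite (_ : [set _ | _] = setT `&` u @^-1` `]-oo, k]%classic).
  by apply: mu; [exact: measurableT|exact: measurable_itv].
by rewrite setTI; apply/seteqP; split=> y; rewrite /= in_itv.
Qed.

Lemma measurable_closed_ball (x : 'rV[R]_n) (r : R) :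
  measurable [set y : Rn R n | enorm (x - y) <= r].
Proof.
rewrite (_ : [set _ | _] = setT `&` (fun y : Rn R n => enorm (x - y)) @^-1`
    `]-oo, r]%classic).
  apply: measurable_enormB_section; [exact: measurableT|exact: measurable_itv].
by rewrite setTI; apply/seteqP; split=> y; rewrite /= in_itv.
Qed.

(** The separation hypothesis bounds the loss through the tail integral, the density hypothesis
    gives the gain a set of measure [b], and the numerical condition makes the gain win. The two
    applications differ only in where [b] comes from. *)
Lemma minimizer_le (u : 'rV[R]_n -> R) (k d rho b : R) :
  minimizer s g Om u -> 0 < d -> 0 < rho -> rho <= d -> 0 <= b ->
  {ae lebesgue n, forall y, ~ Om y -> k < u y ->
    forall x, Om x -> d <= enorm (x - y)} ->
  {ae lebesgue n, forall x, Om x -> k < u x ->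
    (b%:E <= lebesgue n ([set y : Rn R n | (u y <= k - d)%R] `&`
                         [set y : Rn R n | (enorm (x - (y : 'rV[R]_n)) <= rho)%R]))%E} ->
  2 * (L * (C * (d `^ s)^-1)) < gam * (rho `^ (n%:R + s))^-1 * b ->
  {ae lebesgue n, forall x, Om x -> u x <= k}.
Proof.
move=> [uW umin] d0 rho0 rhod b0 sep dens big.
have mu : measurable_fun [set: Rn R n] u by case: uW.
have mOm : measurable (Om : set (Rn R n)) by exact: open_measurable_Rn.
pose w : Rn R n -> R := overshoot Om u k.
have w0 x : 0 <= w x by exact: overshoot_ge0.
have mw : measurable_fun setT w by exact: measurable_overshoot.
pose D : set (Rn R n) := high_outside Om u k.
have mD : measurable D.
  rewrite (_ : D = ~` (Om : set (Rn R n)) `\` [set y | u y <= k]).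
    apply: measurableD; [exact: measurableC|exact: measurable_le_const].
  apply/seteqP; split=> y /= [H1 H2]; split=> //; last by rewrite ltNge; apply/negP.
  by apply/negP; rewrite -ltNge.
pose B : set (Rn R n) := [set y | u y <= k - d].
have mB : measurable B by exact: measurable_le_const.
pose E : set (Rn R n * Rn R n) := [set z | enorm ((z.1 : 'rV[R]_n) - z.2) <= rho].
have mE : measurable E.
  rewrite (_ : E = setT `&` (fun z : Rn R n * Rn R n =>
    enorm ((z.1 : 'rV[R]_n) - z.2)) @^-1` `]-oo, rho]%classic).
    by apply: measurable_enormB; [exact: measurableT|exact: measurable_itv].
  by rewrite setTI; apply/seteqP; split=> y; rewrite /= in_itv.
(* [M] is the loss bound of [energy_gain_ge], and [P] below is the gain bound of [energy_gain_le],
   restricted to the pairs where it applies. *)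
pose M (z : Rn R n * Rn R n) : R :=
  L * w z.1 * \1_D z.2 * rkernel (n%:R + s) z.1 z.2.
pose c := gam * (rho `^ (n%:R + s))^-1.
have c0 : 0 <= c by rewrite mulr_ge0 ?invr_ge0 ?powR_ge0 ?ltW.
pose P (z : Rn R n * Rn R n) : R := c * w z.1 * \1_B z.2 * \1_E z.
have Lw0 x : 0 <= L * w x by apply: mulr_ge0; [exact: ltW|exact: w0].
have cw0 x : 0 <= c * w x by apply: mulr_ge0; [exact: c0|exact: w0].
have mcw (a : R) : measurable_fun setT (fun z : Rn R n * Rn R n => a * w z.1).
  apply: measurable_funM; first exact: measurable_cst.
  apply: (measurableT_comp mw); exact: measurable_fst.
have m1 (A : set (Rn R n)) : measurable A ->
    measurable_fun setT (fun z : Rn R n * Rn R n => \1_A z.2 : R).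
  move=> mA; apply: (measurableT_comp (measurable_indic mA)).
  exact: measurable_snd.
have M0 z : 0 <= M z.
  rewrite /M; apply: mulr_ge0; last exact: rkernel_ge0.
  by apply: mulr_ge0; rewrite ?indicE.
have I0 : (\int[lebesgue n]_x (w x)%:E = 0)%E.
  apply: (@comparison_eq0 _ _ _ (lebesgue n) (Q_domain Om)
    (energy_gain (calG g) s Om u k) M P w (L * (C * (d `^ s)^-1)) (c * b)).
  - apply: measurableC; apply: measurableX; exact: measurableC.
  - exact: measurable_energy_gain.
  - apply: measurable_funM; last exact: measurable_rkernel.
    by apply: measurable_funM; [exact: mcw|exact: m1].
  - apply: measurable_funM; last exact: measurable_indic.
    by apply: measurable_funM; [exact: mcw|exact: m1].
  - exact: mw.
  - exact: M0.
  - move=> z; rewrite /P; apply: mulr_ge0; last by rewrite indicE.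
    by apply: mulr_ge0; rewrite ?indicE.
  - exact: w0.
  - by rewrite !mulr_ge0 ?invr_ge0 ?powR_ge0 ?ltW.
  - exact: big.
  - case=> x y Qxy.
    have [Ox|Ox] := pselect (Om x).
      apply: (@le_trans _ _ (M (x, y))); last by rewrite lerDl; exact: M0.
      exact: energy_gain_ge.
    (* A pair of [Q_domain] has a point in [Om]; symmetry of the gain brings it to the first
       place. *)
    have Oy : Om y by apply: contrapT => Oy; apply: Qxy.
    rewrite energy_gainC //.
    apply: (@le_trans _ _ (M (y, x))); last by rewrite lerDr; exact: M0.
    exact: energy_gain_ge.
  - case=> x y _; rewrite /P /= !indicE.
    have [By|By] := boolP ((y : Rn R n) \in B); last by rewrite mulr0 mul0r le_max lexx orbT.
    have [Exy|Exy] := boolP (((x, y) : Rn R n * Rn R n) \in E); last first.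
      by rewrite mulr0 le_max lexx orbT.
    rewrite !mulr1; apply: (energy_gain_le gam_gt0 s_gt0 calG_lin Om d0 rho0 rhod).
    - by move/set_mem: Exy.
    - by move/set_mem: By.
  - case=> x y Qxy; rewrite /P /= /w overshoot_out ?mulr0 ?mul0r //.
    by move=> Ox; apply: Qxy => -[].
  - move=> x; have [wx|wx] := eqVneq (w x) 0.
      rewrite wx mulr0 integral0_eq // => y _.
      by rewrite /M /= wx mulr0 !mul0r.
    have [Ox kx] := overshoot_gt0 wx.
    have -> : L * (C * (d `^ s)^-1) * w x = L * w x * (C * (d `^ s)^-1) by ring.
    pose F : set (Rn R n) := [set y | d <= enorm (x - (y : 'rV[R]_n))].
    have mF : measurable F.
      rewrite (_ : F = setT `&` (fun y : Rn R n => enorm ((x : 'rV[R]_n) - y)) @^-1` `[d, +oo[%classic).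
        by apply: measurable_enormB_section; [exact: measurableT|exact: measurable_itv].
      by rewrite setTI; apply/seteqP; split=> y; rewrite /= in_itv /= andbT.
    have DF : {ae lebesgue n, forall y, D y -> F y}.
      by apply: sub_ae sep => y H [Oy ky]; exact: H.
    exact: (integral_indic_mul_le mD mF (measurable_rkernel_section (n%:R + s) x)
      (Lw0 x) (rkernel_ge0 (n%:R + s) x) DF (tail_le x d0)).
  - apply: sub_ae dens => x dx; have [wx|wx] := eqVneq (w x) 0.
      rewrite wx mulr0; apply: integral_ge0 => y _.
      by rewrite /P /= wx mulr0 !mul0r.
    have [Ox kx] := overshoot_gt0 wx.
    have -> : c * b * w x = c * w x * b by ring.
    exact: (integral_indic_mul_ge mB (measurable_closed_ball x rho) (cw0 x) (dx Ox kx)).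
  - have uOm : (lebesgue n).-integrable (Om : set (Rn R n)) (EFin \o u) by case: uW.
    have /integrableP[_] : (lebesgue n).-integrable (Om : set (Rn R n)) (EFin \o w).
      apply: (integrable_le_addr mOm (bounded_finite_measure Om_open Om_bounded) _ uOm (k := k)).
        exact: measurable_funTS.
      move=> x Ox; rewrite ger0_norm // /w /overshoot mem_set // ge_max.
      rewrite addr_ge0 // andbT; apply: le_trans (ler_norm _) _.
      by apply: le_trans (ler_normD _ _) _; rewrite normrN.
    apply: le_lt_trans; rewrite le_eqVlt; apply/orP; left; apply/eqP.
    rewrite [RHS]integral_mkcond; apply: eq_integral => x _.
    rewrite patchE /=; case: ifPn => [_|]; first by rewrite ger0_norm.
    by rewrite notin_setE => Ox; rewrite /w overshoot_out.
  - apply: umin.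
      exact: competitor_in_Ws.
    by apply: nearW => x Ox; rewrite overshoot_out // subr0.
have := ae_eq0_integral0 mw w0 I0.
apply: sub_ae => x wx Ox; rewrite leNgt; apply/negP => kx.
move: wx; rewrite /w /overshoot mem_set // => /eqP.
by rewrite gt_eqF // lt_max subr_gt0 kx.
Qed.

(** With rho = t d and room e (a rho)^n, both sides carry the same factor d^-s, so the condition on
    t does not involve d. *)
Lemma density_condition (t d a e : R) : 0 < t -> 0 < d ->
  2 * L * C < gam * e * a ^+ n * (t `^ s)^-1 ->
  2 * (L * (C * (d `^ s)^-1)) <
    gam * ((t * d) `^ (n%:R + s))^-1 * (e * (a * (t * d)) ^+ n).
Proof.
move=> t0 d0 H; have td0 : 0 < t * d by rewrite mulr_gt0.
have ds0 : 0 < d `^ s by rewrite powR_gt0.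
have tdn0 : (t * d) ^+ n != 0 by rewrite expf_neq0// gt_eqF.
rewrite powRD; last by rewrite (gt_eqF td0) implybT.
rewrite powR_mulrn ?(ltW td0)// powRM ?(ltW t0) ?(ltW d0)// (exprMn _ a).
rewrite [ltLHS](_ : _ = 2 * L * C * (d `^ s)^-1); last by ring.
rewrite [ltRHS](_ : _ = gam * e * a ^+ n * (t `^ s)^-1 * (d `^ s)^-1).
  by rewrite ltr_pM2r// invr_gt0.
have ts0 : t `^ s != 0 by rewrite gt_eqF// powR_gt0.
by field; rewrite ts0 (gt_eqF ds0) tdn0.
Qed.

Lemma separated_outside (u : 'rV[R]_n -> R) (k d : R) :
  {ae lebesgue n, forall y, (sublevel_domain Om d `\` Om) y -> u y <= k} ->
  {ae lebesgue n, forall y, ~ Om y -> k < u y ->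
    forall x, Om x -> d <= enorm (x - y)}.
Proof.
apply: sub_ae => y H Oy ky x Ox; rewrite leNgt; apply/negP => xy.
have := H (conj (sublevel_domain_near Ox xy) Oy).
by rewrite leNgt ky.
Qed.

Lemma measurable_low_ball (u : 'rV[R]_n -> R) (k rho : R) (x : 'rV[R]_n) :
  measurable_fun [set: Rn R n] u ->
  measurable ([set y : Rn R n | u y <= k] `&`
              [set y : Rn R n | enorm (x - (y : 'rV[R]_n)) <= rho]).
Proof.
move=> mu; apply: measurableI; first exact: measurable_le_const.
exact: measurable_closed_ball.
Qed.

(** High values inside [Om] occupy little measure by integrability, and near [Om] the outer values
    are at most [K]; so for a high level at least half of a cube around x is low. *)
Lemma minimizer_bounded_above (u : 'rV[R]_n -> R) (d K : R) :
  (1 <= n)%N -> minimizer s g Om u -> 0 < d ->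
  {ae lebesgue n, forall y, (sublevel_domain Om d `\` Om) y -> u y <= K} ->
  exists k, {ae lebesgue n, forall x, Om x -> u x <= k}.
Proof.
move=> n1 umin d0 uK; have [[mu iu _] _] := umin.
have mOm : measurable (Om : set (Rn R n)) by exact: open_measurable_Rn.
have nR : 0 < n%:R :> R by rewrite ltr0n.
have a0 : 0 < 2 / n%:R :> R by rewrite divr_gt0.
(* In [density_condition], e = 1/2 stands for half of a cube and a = 2/n for its side: half-side
   rho/n fits in the ball of radius [rho]. *)
have c10 : 0 < gam * 2^-1 * (2 / n%:R) ^+ n.
  by rewrite !mulr_gt0 ?invr_gt0 ?exprn_gt0.
have t00 : 0 < 2^-1 :> R by rewrite invr_gt0.
have [t [t0 t2 Ht]] := small_power (2 * L * C) s_gt0 c10 t00.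
pose rho := t * d.
have rho0 : 0 < rho by rewrite mulr_gt0.
have rhod : rho < d.
  rewrite /rho gtr_pMl//; apply: le_lt_trans t2 _.
  by rewrite invf_lt1// ltr1n.
pose V := (2 / n%:R * rho) ^+ n.
have V0 : 0 < V by rewrite exprn_gt0// mulr_gt0.
have V20 : 0 < V / 2 by rewrite divr_gt0.
have [m m0 Hm] := chebyshev_ge mOm iu V20.
(* So that [k - d] exceeds both the Chebyshev threshold and the outer bound. *)
pose k := Num.max m K + d.
have kd : k - d = Num.max m K by rewrite /k addrK.
have Kk : K <= k by rewrite /k (@le_trans _ _ (Num.max m K))// ?le_max ?lexx ?orbT// lerDl ltW.
exists k; apply: (minimizer_le umin d0 rho0 (ltW rhod) (ltW V20)).
- apply: separated_outside; apply: sub_ae uK => y H /H uyK.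
  exact: le_trans uyK Kk.
- apply: (@sub_ae _ _ _ _ setT); last by exact: aeW.
  move=> x _ Ox kx.
  set S := _ `&` _.
  have mS : measurable S by exact: measurable_low_ball.
  pose A : set (Rn R n) := Om `&` [set y | Num.max m K < u y].
  have mA : measurable A.
    apply: measurableI => //; rewrite (_ : [set y | _] = ~` [set y | u y <= Num.max m K]).
      apply: measurableC; exact: measurable_le_const.
    apply/seteqP; split=> y /=; first by rewrite ltNge => /negP.
    by move/negP; rewrite -ltNge.
  have A2 : (lebesgue n A <= (V / 2)%:E)%E by apply: Hm; rewrite le_max lexx.
  (* A point of the cube that is not low must lie in [Om]: outside, being within d of x, it
     satisfies u <= K almost everywhere. *)
  have H : (lebesgue n (cube x (rho / n%:R)) <= lebesgue n (S `|` A))%E.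
    apply: le_measure_ae; [exact: measurable_cube|exact: measurableU|].
    apply: sub_ae uK => y uyK /cube_enorm; rewrite mulrCA mulfV ?gt_eqF// mulr1 => xy.
    have [uy|uy] := leP (u y) (k - d); first by left.
    right; rewrite kd in uy; split=> //; apply: contrapT => Oy.
    have : u y <= K by apply: uyK; split=> //; apply: sublevel_domain_near Ox _; exact: le_lt_trans rhod.
    by rewrite leNgt (le_lt_trans _ uy)// le_max lexx orbT.
  have {}H : (V%:E <= lebesgue n (S `|` A))%E.
    apply: le_trans H; rewrite [leRHS](_ : _ = ((2 * (rho / n%:R)) ^+ n)%:E).
      by rewrite /V mulrA mulrAC.
    by apply: lebesgue_cube; rewrite divr_ge0// ltW.
  have {}H : (V%:E <= lebesgue n S + (V / 2)%:E)%E.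
    apply: le_trans H _; apply: le_trans (measureU2 _ mS mA) _.
    exact: leeD2l.
  have VE : V%:E = ((V / 2)%:E + (V / 2)%:E)%E by rewrite -EFinD -splitr.
  by move: H; rewrite VE leeD2rE.
- rewrite -[V / 2]mulrC; exact: density_condition.
Qed.

Lemma boundary_nonempty : (1 <= n)%N -> Om !=set0 -> boundary Om !=set0.
Proof.
move=> n1 [x Ox]; have [M M0 OM] := bounded_set_enorm Om_bounded.
have Oy : ~ Om (const_mx (M + 1)).
  move=> /OM; apply/negP; rewrite -ltNge.
  apply: lt_le_trans (coord_le_enorm _ (Ordinal n1)); rewrite mxE.
  by apply: lt_le_trans (ler_norm _); rewrite ltrDl.
by have [z Oz _] := exists_boundary_between Ox Oy; exists z.
Qed.

(** At level d + K, low means at most [K], which holds almost everywhere on a corkscrew ball inside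
    the outer layer. The ratio t, hence [theta], is chosen before [u], [d] and [K]. *)
Lemma minimizer_le_near_boundary (c : R) : (1 <= n)%N -> 0 < c ->
  (forall p r, boundary Om p -> 0 < r -> corkscrew Om c p r) ->
  exists2 theta : R, 0 < theta < 1 & forall (u : 'rV[R]_n -> R) (d K : R),
    0 < d -> minimizer s g Om u ->
    {ae lebesgue n, forall y, (sublevel_domain Om d `\` Om) y -> u y <= K} ->
    {ae lebesgue n, forall y, sublevel_domain Om (- (theta * d)) y -> u y <= K} ->
    {ae lebesgue n, forall x, Om x -> u x <= d + K}.
Proof.
move=> n1 c0 corks.
have nR : 0 < n%:R :> R by rewrite ltr0n.
have a0 : 0 < c / n%:R by rewrite divr_gt0.
(* Here e = 1 and a = c/n: a cube of side c rho / n fits in a corkscrew ball of radius c rho / 2. *)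
have c10 : 0 < gam * 1 * (c / n%:R) ^+ n by rewrite !mulr_gt0 ?exprn_gt0.
have t00 : 0 < 2^-1 :> R by rewrite invr_gt0.
have [t [t0 t2 Ht]] := small_power (2 * L * C) s_gt0 c10 t00.
have t1 : t < 1 by apply: le_lt_trans t2 _; rewrite invf_lt1// ltr1n.
(* Then theta d = rho/4 lies strictly below rho/2, the slack that [near_boundary] asks for; the
   corkscrew ball at scale rho/2 stays within [rho] of x. *)
exists (t / 4); first by apply/andP; split; move: t0 t1; lra.
move=> u d K d0 umin uout uin; have [[mu _ _] _] := umin.
pose rho := t * d.
have rho0 : 0 < rho by rewrite mulr_gt0.
have rhod : rho < d by rewrite /rho gtr_pMl.
pose b := 1 * (c / n%:R * rho) ^+ n.
have b0 : 0 <= b by rewrite /b mul1r exprn_ge0// mulr_ge0// ltW.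
apply: (minimizer_le umin d0 rho0 (ltW rhod) b0).
- apply: separated_outside; apply: sub_ae uout => y H /H uyK.
  by rewrite (le_trans uyK)// lerDr ltW.
- apply: sub_ae uin => x xin Ox kx.
  (* Deep points satisfy u <= K by hypothesis, so a point above the level is close to the
     boundary. *)
  have xfar : ~ sublevel_domain Om (- (t / 4 * d)) x.
    by move=> /xin; rewrite leNgt (le_lt_trans _ kx)// lerDr ltW.
  have r0 : 0 < rho / 2 by rewrite divr_gt0.
  have rE : t / 4 * d < rho / 2 by move: rho0; rewrite /rho; lra.
  have [p Bp xp] := near_boundary (boundary_nonempty n1 (ex_intro _ x Ox)) Ox xfar rE.
  have [z zP] := corks p _ Bp r0.
  set S := _ `&` _.
  have mS : measurable S by exact: measurable_low_ball.
  apply: (@le_trans _ _ (lebesgue n (cube z (c * (rho / 2) / n%:R)))).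
    rewrite [leRHS](_ : _ = ((2 * (c * (rho / 2) / n%:R)) ^+ n)%:E).
      rewrite lee_fin /b mul1r le_eqVlt; apply/orP; left; apply/eqP.
      by congr (_ ^+ _); field; rewrite gt_eqF.
    by apply: lebesgue_cube; rewrite divr_ge0// ltW// mulr_gt0.
  apply: le_measure_ae; [exact: measurable_cube|exact: mS|].
  apply: sub_ae uout => y uyK /cube_enorm; rewrite mulrC divfK ?gt_eqF// enormB.
  move=> /zP[yp Oy]; split => /=.
    (* The corkscrew ball lies outside [Om] and within rho/2 < d of the boundary point p, hence in
       the layer where u <= K. *)
    rewrite (addrC d) addrK; apply: uyK; split=> //.
    apply: sublevel_domain_boundary d0 Bp _; apply: le_lt_trans yp _.
    by move: rho0 rhod; lra.
  apply: le_trans (enorm_triangle p _ _) _.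
  rewrite (enormB p) [leRHS]splitr; apply: lerD => //; exact: ltW.
- exact: density_condition.
Qed.

End minimizer_bound.

(** * The L-infinity norm as an almost-everywhere bound, and the final estimate *)

Section Linfty_norm.
Context {R : realType} {n : nat}.
Implicit Types (u : 'rV[R]_n -> R) (A B : set 'rV[R]_n).

Lemma lebesgue_setT_gt0 : (0 < lebesgue n [set: Rn R n])%E.
Proof.
apply: (@lt_le_trans _ _ (lebesgue n (cube (0 : 'rV[R]_n) 1))).
  rewrite [ltRHS](_ : _ = ((2 * 1) ^+ n)%:E); last exact: lebesgue_cube.
  by rewrite lte_fin exprn_gt0// mulr_gt0.
by apply: le_measure; rewrite ?inE//; exact: measurable_cube.
Qed.

Lemma Linfty_norm_leP u A (K : R) : 0 <= K ->
  (Linfty_norm u A <= K%:E)%E <->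
  {ae lebesgue n, forall x, A x -> `|u x| <= K}.
Proof.
move=> K0.
have H := @Lnorm_oo_leP _ (Rn R n) R (lebesgue n) A u K lebesgue_setT_gt0 K0.
by split => [/(H.1)|/(H.2)].
Qed.

Lemma Linfty_norm_ae u A : (Linfty_norm u A < +oo)%E ->
  {ae lebesgue n, forall x, A x -> `|u x| <= fine (Linfty_norm u A)}.
Proof.
move=> Aoo; have A0 : (0 <= Linfty_norm u A)%E by exact: Lnorm_ge0.
apply/Linfty_norm_leP; first exact: fine_ge0.
by rewrite fineK// ge0_fin_numE.
Qed.

Lemma Linfty_norm_sub u A B : A `<=` B -> (Linfty_norm u A <= Linfty_norm u B)%E.
Proof.
move=> AB; have B0 : (0 <= Linfty_norm u B)%E by exact: Lnorm_ge0.
have [Boo|] := ltP (Linfty_norm u B) +oo%E; last by rewrite leye_eq => /eqP ->; rewrite leey.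
rewrite -(fineK (_ : Linfty_norm u B \is a fin_num)) ?ge0_fin_numE//.
apply/Linfty_norm_leP; first exact: fine_ge0.
by apply: sub_ae (Linfty_norm_ae Boo) => x H /AB.
Qed.

End Linfty_norm.

Theorem proposition3p6 (R : realType) (n : nat) (n_ge1 : (1 <= n)%N)
  (s : R) (s01 : 0 < s < 1)
  (g : R -> R) (g_range : forall t, 0 < g t <= 1)
  (g_even : forall t, g (- t) = g t) (g_continuous : continuous g)
  (g_moment : (\int[@lebesgue_measure R]_t (g t * `|t|)%:E < +oo)%E)
  (Om : set 'rV[R]_n) (Om_bounded : bounded_set Om) (Om_open : open Om)
  (Om_lipschitz : lipschitz_boundary Om) :
  exists2 theta : R, 0 < theta < 1 &
    forall (u : 'rV[R]_n -> R) (d : R), 0 < d ->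
      minimizer s g Om u ->
      (Linfty_norm u (sublevel_domain Om d `\` Om) < +oo)%E ->
      (Linfty_norm u Om < +oo)%E /\
      (Linfty_norm u (Om `\` sublevel_domain Om (- (theta * d))) <=
       d%:E + maxe (Linfty_norm u (sublevel_domain Om (- (theta * d))))
                   (Linfty_norm u (sublevel_domain Om d `\` Om)))%E.
Proof.
have [s0 s1] := andP s01.
have [L [gam [[L0 gam0] Gn _ Glip Glin]]] :=
  calG_growth g_range g_even g_continuous g_moment.
have [C C0 tail] := @tail_integral R n s s0.
have [c c0 corks] := exterior_corkscrew n_ge1 Om_bounded Om_open Om_lipschitz.
have [theta th near_le] := minimizer_le_near_boundary L0 gam0 s0 C0 Gn Glip Glin
  tail Om_open Om_bounded n_ge1 c0 corks.
exists theta => // u d d0 umin uout.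
have uminN := minimizerN Gn umin.
have above := minimizer_bounded_above L0 gam0 s0 C0 Gn Glip Glin tail
  Om_open Om_bounded n_ge1.
have two_sided (P : set 'rV[R]_n) k : {ae lebesgue n, forall x, P x -> `|u x| <= k} ->
    {ae lebesgue n, forall x, P x -> u x <= k} /\
    {ae lebesgue n, forall x, P x -> - u x <= k}.
  by move=> H; split; apply: sub_ae H => x H /H; rewrite ler_norml; lra.
have one_sided (P : set 'rV[R]_n) k : {ae lebesgue n, forall x, P x -> u x <= k} ->
    {ae lebesgue n, forall x, P x -> - u x <= k} ->
    {ae lebesgue n, forall x, P x -> `|u x| <= k}.
  by apply: sub_ae2 => x H1 H2 Px; have := H1 Px; have := H2 Px; rewrite ler_norml; lra.
have uOm : (Linfty_norm u Om < +oo)%E.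
  have [] := two_sided _ _ (Linfty_norm_ae uout).
  move=> /(above _ _ _ umin d0)[k1 uk1] /(above _ _ _ uminN d0)[k2 uk2].
  pose k := Num.max 0 (Num.max k1 k2).
  apply: (@le_lt_trans _ _ k%:E); last exact: ltry.
  apply/Linfty_norm_leP; first by rewrite le_max lexx.
  apply: one_sided; [apply: sub_ae uk1 => x H /H|apply: sub_ae uk2 => x H /H];
    by move=> ux; rewrite /k !le_max ux ?orbT.
split=> //.
set N1 := Linfty_norm u (sublevel_domain Om _).
set N2 := Linfty_norm u (_ `\` Om).
(* The boundedness on [Om] just obtained makes the maximum of the two norms a real number, usable as
   the level [K]. *)
have N1fin : (N1 < +oo)%E.
  apply: le_lt_trans uOm; apply: Linfty_norm_sub => x.
  by apply: sublevel_domain_neg; rewrite oppr_le0 mulr_ge0// ltW//; case/andP: th.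
have N0 : (0 <= maxe N1 N2)%E by rewrite le_max Lnorm_ge0.
have Nfin : maxe N1 N2 \is a fin_num.
  rewrite ge0_fin_numE// gt_max N1fin; exact: uout.
rewrite -(fineK Nfin) -EFinD; set K := fine _.
have K0 : 0 <= K by exact: fine_ge0.
have [in1 in2] : {ae lebesgue n, forall x, sublevel_domain Om (- (theta * d)) x -> u x <= K} /\
    {ae lebesgue n, forall x, sublevel_domain Om (- (theta * d)) x -> - u x <= K}.
  apply: two_sided; apply/Linfty_norm_leP => //.
  by rewrite /K (fineK Nfin) le_max lexx.
have [out1 out2] : {ae lebesgue n, forall x, (sublevel_domain Om d `\` Om) x -> u x <= K} /\
    {ae lebesgue n, forall x, (sublevel_domain Om d `\` Om) x -> - u x <= K}.
  apply: two_sided; apply/Linfty_norm_leP => //.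
  by rewrite /K (fineK Nfin) le_max lexx orbT.
apply/Linfty_norm_leP; first by rewrite addr_ge0// ltW.
have := one_sided _ _ (near_le _ _ _ d0 umin out1 in1) (near_le _ _ _ d0 uminN out2 in2).
by apply: sub_ae => x H [/H].
Qed.
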